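(* Let $1<p<\infty$ and $\beta\ge0$, and let $\Omega\subsetneq\mathbb R^n$ be a nonempty open set. Assume that there exists a constant $C>0$ such that $$|u(x)|\le C\,d(x,\Omega^c)^{1-\frac{\beta}{p}}\Big(\mathcal M_{2d(x,\Omega^c)}\big(|\nabla u|^p\,d(\cdot,\Omega^c)^{\beta}\big)(x)\Big)^{\frac1p}$$ for every $x\in\Omega$ and every $u\in\operatorname{Lip}_0(\Omega)$. Then there exists a constant $C'>0$, independent of $u$, such that the weighted $(p,\beta)$-Hardy inequality $$\int_\Omega|u(x)|^p\,d(x,\Omega^c)^{\beta-p}\,dx\le C'\int_\Omega|\nabla u(x)|^p\,d(x,\Omega^c)^{\beta}\,dx$$ holds for every $u\in\operatorname{Lip}_0(\Omega)$.
   Context: $\mathbb R^n$ is equipped with the Euclidean distance and Lebesgue measure. $\Omega^c=\mathbb R^n\setminus\Omega$ and $d(x,\Omega^c)$ is the distance from $x$ to $\Omega^c$. $\operatorname{Lip}_0(\Omega)$ is the space of Lipschitz functions $u:\mathbb R^n\to\mathbb R$ that vanish on $\Omega^c$ (so $\nabla u$ exists almost everywhere). For measurable $f$ and $x\in\Omega$, $\mathcal M_{2d(x,\Omega^c)}f(x)=\sup_{0<r<2d(x,\Omega^c)}\frac1{|B(x,r)|}\int_{B(x,r)}|f(y)|\,dy$ is the restricted maximal function, where $|B(x,r)|$ denotes Lebesgue measure of the open ball $B(x,r)$. *)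

(* Defs.v *)
From HB Require Import structures.
From mathcomp Require Import all_boot all_order all_algebra.
From mathcomp Require Import all_classical all_reals all_analysis.
From mathcomp Require Import measurable_realfun.

Set Implicit Arguments.
Unset Strict Implicit.
Unset Printing Implicit Defensive.
Import Order.TTheory GRing.Theory Num.Theory.
Import numFieldNormedType.Exports.

Local Open Scope classical_set_scope.
Local Open Scope ring_scope.

(* R^n is 'rV[R]_n. Its library topology is the one of the sup norm, which is
   the Euclidean topology; its measurable sets are the Borel sets. *)
Section borel_matrix.
Context {R : realType} {m n : nat}.

HB.instance Definition _ :=
  Measurable.copy 'M[R]_(m, n) (g_sigma_algebraType [set A : set 'M[R]_(m, n) | open A]).

Lemma open_measurable_mx (A : set 'M[R]_(m, n)) : open A -> measurable A.
Proof. exact: sub_sigma_algebra. Qed.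

Lemma continuous_measurable_mx (f : 'M[R]_(m, n) -> R) :
  continuous f -> measurable_fun setT f.
Proof.
move=> cf; apply: (measurability _ (RGenOpens.measurableE R)).
move=> _ [_ [a [b ->] <-]]; rewrite setTI; apply: open_measurable_mx.
by apply: open_comp; [move=> v _; exact: cf|exact: interval_open].
Qed.

End borel_matrix.

Definition consrow {R : realType} {n : nat} (p : measurableTypeR R * 'rV[R]_n)
  : 'rV[R]_n.+1 := row_mx (p.1)%:M p.2.

Lemma consrow0 {R : realType} {n : nat} (p : measurableTypeR R * 'rV[R]_n) :
  consrow p 0 ord0 = p.1.
Proof.
rewrite /consrow (_ : ord0 = lshift n (ord0 : 'I_1)); last exact: val_inj.
by rewrite (row_mxEl p.1%:M p.2) mxE mulr1n.
Qed.

Lemma consrowS {R : realType} {n : nat} (p : measurableTypeR R * 'rV[R]_n) i :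
  consrow p 0 (lift ord0 i) = p.2 0 i.
Proof. by rewrite /consrow -rshift1 (row_mxEr p.1%:M p.2). Qed.

Definition unconsrow {R : realType} {n : nat} (v : 'rV[R]_n.+1)
  : measurableTypeR R * 'rV[R]_n := (v 0 ord0, \row_(i < n) v 0 (lift ord0 i)).

Lemma consrowK {R : realType} {n : nat} : cancel (@consrow R n) unconsrow.
Proof.
move=> p; rewrite /unconsrow consrow0 [RHS]surjective_pairing; congr pair.
by apply/rowP => i; rewrite mxE consrowS.
Qed.

Lemma unconsrowK {R : realType} {n : nat} : cancel (@unconsrow R n) consrow.
Proof.
move=> v; apply/rowP => i.
by case: (unliftP ord0 i) => [j ->|->]; rewrite ?consrowS ?consrow0 //= mxE.
Qed.

Section consrow_measurable.
Context {R : realType}.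

Definition rat_box n (q : 'rV[rat]_n) (k : nat) : set 'rV[R]_n :=
  [set v | forall i, ball (ratr (q 0 i) : R) k.+1%:R^-1 (v 0 i)].

Lemma open_rat_box n (q : 'rV[rat]_n) k : open (rat_box q k).
Proof.
rewrite openE => v /= qv; exists (fun i j => ball (ratr (q 0 j) : R) k.+1%:R^-1).
  by move=> i j; rewrite (ord1 i); apply: open_nbhs_nbhs; split;
    [exact: ball_open | exact: qv].
by move=> w /= Hw i; exact: Hw.
Qed.

Lemma open_bigcup_rat_box n (U : set 'rV[R]_n) : open U ->
  U = \bigcup_(qk in [set qk : 'rV[rat]_n * nat | rat_box qk.1 qk.2 `<=` U])
        rat_box qk.1 qk.2.
Proof.
move=> oU; apply/seteqP; split; last by move=> v [qk /= + ?]; apply.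
move=> v Uv; have : nbhs v U by exact: open_nbhs_nbhs.
move=> /nbhs_ballP[e /= e0 veU].
have [k ke] : exists k, (k.+1%:R^-1 : R) < e / 2.
  have [k _ /(_ _ (leqnn k))] := near_infty_natSinv_lt (PosNum (divr_gt0 e0 (ltr0n R 2))).
  by exists k.
have /choice[q qv] : forall i, exists q : rat, ball (v 0 i) k.+1%:R^-1 (ratr q : R).
  move=> i; have := @dense_rat R (ball (v 0 i) k.+1%:R^-1).
  case=> [||x [vx [q _ qx]]]; last by exists q; rewrite qx.
    by exists (v 0 i); exact: ballxx.
  exact: ball_open.
exists (\row_i q i, k); last by move=> i /=; rewrite mxE; exact/ball_sym/qv.
move=> w /= qw; apply: veU; split => // i j; rewrite (ord1 i).
have := qw j; rewrite mxE => qwj.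
rewrite (splitr e); apply: (@ball_triangle _ _ (ratr (q j) : R)).
  by apply: le_ball (qv j); exact: ltW.
by apply: le_ball qwj; exact: ltW.
Qed.

Lemma measurable_consrow n : measurable_fun setT (@consrow R n).
Proof.
apply: (measurability [set A : set 'rV[R]_n.+1 | open A]) => // _ [U oU <-]; rewrite setTI.
rewrite (open_bigcup_rat_box oU) preimage_bigcup.
rewrite bigcup_mkcond; apply: countable_bigcupT_measurable => [|[q k]].
  exact: countableP.
case: ifPn => // _; rewrite (_ : _ @^-1` _ =
  ball (ratr (q 0 ord0) : R) k.+1%:R^-1 `*`
  @rat_box n (\row_(i < n) q 0 (lift ord0 i)) k).
  apply: measurableX; first exact: measurable_ball.
  by apply: sub_sigma_algebra; exact: open_rat_box.
apply/seteqP; split=> [[x v] /= qxv|[x v] /= [qx qv] i].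
  split => [|i]; first by have := qxv ord0; rewrite consrow0.
  by have := qxv (lift ord0 i); rewrite consrowS mxE.
case: (unliftP ord0 i) => [j ->|->]; last by rewrite consrow0.
by have := qv j; rewrite consrowS mxE.
Qed.

Lemma measurable_unconsrow n : measurable_fun setT (@unconsrow R n).
Proof.
apply: measurable_fun_pair => /=.
  by apply: (@continuous_measurable_mx R 1 n.+1); exact: coord_continuous.
apply: (measurability [set A : set 'rV[R]_n | open A]) => // _ [U oU <-].
rewrite setTI; apply: sub_sigma_algebra => /=.
apply: open_comp => // v _ A /= [P vP PA].
exists (fun i (j : 'I_n.+1) => if unlift ord0 j is Some k then P 0 k else setT).
  move=> i j; case: unliftP => [k ->|_]; last exact: filterT.
  by have := vP 0 k; rewrite mxE (ord1 i).
move=> w wP; apply: PA => i j; rewrite mxE (ord1 i).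
by have := wP 0 (lift ord0 j); rewrite liftK.
Qed.

End consrow_measurable.

Section lebesgue_cons.
Context {R : realType} {n : nat} (mu : {sigma_finite_measure set 'rV[R]_n -> \bar R}).
Local Open Scope ereal_scope.

Definition lebesgue_cons : set 'rV[R]_n.+1 -> \bar R :=
  pushforward (@lebesgue_measure R \x mu) (@consrow R n).

Let lebesgue_cons0 : lebesgue_cons set0 = 0.
Proof. by rewrite /lebesgue_cons /pushforward preimage_set0 measure0. Qed.

Let lebesgue_cons_ge0 A : 0 <= lebesgue_cons A.
Proof. exact: integral_ge0. Qed.

Let lebesgue_cons_sigma_additive : semi_sigma_additive lebesgue_cons.
Proof.
have mc := @measurable_consrow R n.
exact: (@measure_semi_sigma_additive _ _ _
  (pushforward (@lebesgue_measure R \x mu) (@consrow R n))).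
Qed.

HB.instance Definition _ := isMeasure.Build _ _ _ lebesgue_cons
  lebesgue_cons0 lebesgue_cons_ge0 lebesgue_cons_sigma_additive.

Let lebesgue_cons_sigma_finite : sigma_finite setT lebesgue_cons.
Proof.
have /sigma_finiteP[F [TF ndF Foo]] := sigma_finiteT (@lebesgue_measure R).
have /sigma_finiteP[G [TG ndG Goo]] := sigma_finiteT mu.
exists (fun i => @unconsrow R n @^-1` (F i `*` G i)).
  rewrite -preimage_bigcup; apply/esym/seteqP; split=> // v _ /=.
  have [i _ Fi] : (\bigcup_i F i) (v 0%R ord0) by rewrite -TF.
  have [j _ Gj] : (\bigcup_i G i) (unconsrow v).2 by rewrite -TG.
  exists (maxn i j) => //; split.
    by move: Fi; exact/subsetPset/ndF/leq_maxl.
  by move: Gj; exact/subsetPset/ndG/leq_maxr.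
move=> i; have [mF Fi] := Foo i; have [mG Gi] := Goo i; split.
  rewrite -[X in measurable X]setTI; apply: measurable_unconsrow => //.
  exact: measurableX.
rewrite /lebesgue_cons /pushforward -comp_preimage.
rewrite (_ : _ \o _ = id); last by apply/funext; exact: consrowK.
by rewrite preimage_id product_measure1E// lte_mul_pinfty// ge0_fin_numE.
Qed.

HB.instance Definition _ := Measure_isSigmaFinite.Build _ _ _ lebesgue_cons
  lebesgue_cons_sigma_finite.
End lebesgue_cons.

(* The n-fold product of the one-dimensional Lebesgue measure, on Borel sets. *)
Fixpoint lebesgue_rV {R : realType} (n : nat) :
    {sigma_finite_measure set 'rV[R]_n -> \bar R} :=
  if n is n'.+1 then lebesgue_cons (lebesgue_rV n') else \d_ (0 : 'rV[R]_0).

Lemma measurable_box {R : realType} (n : nat) (a b : 'I_n -> R) :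
  measurable [set v : 'rV[R]_n | forall i, a i <= v 0 i <= b i].
Proof.
rewrite (_ : [set _ | _] =
  ~` \bigcup_i ~` ((fun v : 'rV[R]_n => v 0 i) @^-1` `[a i, b i])).
  apply: measurableC; apply: countable_bigcupT_measurable => [|i].
    exact: countableP.
  apply: measurableC; rewrite -[X in measurable X]setTI.
  by apply: continuous_measurable_mx => //; exact: coord_continuous.
rewrite setC_bigcup; apply/seteqP; split=> [v vab i _|v vab i].
  by rewrite setCK /= in_itv/=; exact: vab.
by have := vab i I; rewrite setCK /= in_itv.
Qed.

Lemma lebesgue_rV_box {R : realType} (n : nat) (a b : 'I_n -> R) :
  (forall i, a i <= b i) ->
  lebesgue_rV n [set v : 'rV[R]_n | forall i, a i <= v 0 i <= b i] =
  (\prod_i (b i - a i))%:E.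
Proof.
elim: n a b => [|n IH] a b ab.
  by rewrite big_ord0 /= diracE mem_set//= => -[].
rewrite big_ord_recl /= /lebesgue_cons /pushforward.
rewrite (_ : _ @^-1` _ = `[a ord0, b ord0] `*`
  [set v : 'rV[R]_n | forall i, a (lift ord0 i) <= v 0 i <= b (lift ord0 i)]).
  rewrite product_measure1E//=; last exact: measurable_box.
  rewrite IH// lebesgue_measure_itv/= lte_fin EFinM.
  case: ltP => // ba; rewrite (_ : b ord0 - a ord0 = 0) ?mul0e//.
  by apply/eqP; rewrite subr_eq0 eq_le ba ab.
apply/seteqP; split=> [[x v] /= xv|[x v] /= [xab vab] i].
  rewrite in_itv/=; split=> [|i]; first by have := xv ord0; rewrite consrow0.
  by have := xv (lift ord0 i); rewrite consrowS.
case: (unliftP ord0 i) => [j ->|->]; last by rewrite consrow0; rewrite in_itv in xab.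
by rewrite consrowS; exact: vab.
Qed.

Section hardy.
Context {R : realType} {n : nat}.
Implicit Types (Omega : set 'rV[R]_n) (u f : 'rV[R]_n -> R) (x : 'rV[R]_n).

(* The library norm of 'rV[R]_n is the sup norm, so the Euclidean norm, balls
   and distance are introduced separately. *)
Definition enorm (v : 'rV[R]_n) : R := Num.sqrt (\sum_i v 0 i ^+ 2).

Definition eball x (r : R) : set 'rV[R]_n := [set y | enorm (x - y) < r].

(* Only meant for Omega <> setT: otherwise it is inf set0 = 0. *)
Definition dist_compl Omega x : R := inf [set enorm (x - y) | y in ~` Omega].

Definition Lip0 Omega u : Prop :=
  (exists L : R, forall x y, `|u x - u y| <= L * enorm (x - y)) /\
  (forall x, (~` Omega) x -> u x = 0).

(* The row of partial derivatives; for Lipschitz u it is meaningful almost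
   everywhere, and on the exceptional null set 'D_v takes junk values that the
   integrals do not see. *)
Definition gradient u x : 'rV[R]_n := \row_i 'D_(delta_mx 0 i) u x.

Definition restricted_maximal (rho : R) f x : \bar R :=
  ereal_sup [set ((lebesgue_rV n (eball x r))^-1 *
                  \int[lebesgue_rV n]_(y in eball x r) `|f y|%:E)%E
            | r in `]0, rho[ ].

End hardy.

(* Main.v *)
Require Import Defs.
From mathcomp Require Import all_boot all_order all_algebra.
From mathcomp Require Import all_classical all_reals all_analysis.
From mathcomp Require Import measurable_realfun.
From mathcomp Require Import lra ring zify.

(** Let [d] be the distance to the complement of [Omega], let
    [F u = |grad u|^p d^beta] and [H u = |u|^p d^(beta - p)]. The maximal
    operator is not bounded on [L^1], so the pointwise inequality cannot simply
    be raised to the power [p] and integrated. It does give a weak type bound,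
    by a Vitali covering: on the layer [e^(m-1) < d <= e^m], where [d] is
    essentially constant, the measure of the set where a function [v] of
    [Lip0 Omega] satisfies [|v| >= t] is at most a constant times
    [t^(-p) e^(m (p - beta))] times the integral of [F v] over [d < 3 e^m]
    ([weak_layer]).

    Maz'ya's truncation turns this weak bound into a strong one. It is applied to
    [t = 2^j] and [v = min (min ((|u| - t)^+, t), t eta)], where [eta] is a
    cutoff equal to [1] on the layer. The gradient of [v] is that of [u] between
    the levels [t] and [2 t], and is bounded by [t] times the slope of [eta] on
    the set [|u| > t]. Summed over [j], the first contributions have disjoint
    supports and the second ones form a geometric series with sum comparable to
    [|u|^p] ([layer_estimate]). Two choices of [eta] are used. With [eta = 1],
    the integral [J m] of [H u] over the layer is at most [K] times the integral
    of [F u]. With the logarithmic cutoff that vanishes [M] layers closer to the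
    boundary and has slope [1 / (M d)],

      [J m <= K (sum of G j over m - M <= j <= m + 2,
             plus c M^(-p) times the sum of J j over m - M <= j < m)]

    where [G j] is the integral of [F u] over the layer [j].

    Summing the last inequality over [m] counts every layer about [M] times, so
    the total of the [J m] is bounded by a multiple of the total of the [G m]
    plus [K c M^(1 - p)] times itself, up to at most [M] further layers, which
    the first inequality controls. Since [p > 1], this is absorbed for [M] large
    ([layer_absorption]). The absorption is made on finite ranges of layers,
    where all the sums are finite; the whole of [Omega] follows by monotone
    convergence.

    The partial derivatives are estimated at every point by means of one-sided
    difference quotients, and a minimum is used in place of a product with
    [eta]. This avoids Rademacher's theorem and the product rule. *)

Set Implicit Arguments.
Unset Strict Implicit.
Unset Printing Implicit Defensive.
Import Order.TTheory GRing.Theory Num.Theory.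
Import numFieldNormedType.Exports.
Local Open Scope classical_set_scope.
Local Open Scope ring_scope.

(** * The Euclidean norm and the distance to the complement *)

Section euclidean.
Context {R : realType} {n : nat}.
Implicit Types (v w x y : 'rV[R]_n) (Omega : set 'rV[R]_n).

Lemma enorm_ge0 v : 0 <= enorm v.
Proof. exact: sqrtr_ge0. Qed.

Lemma enorm_sqr v : enorm v ^+ 2 = \sum_i v 0 i ^+ 2.
Proof. by rewrite sqr_sqrtr// sumr_ge0// => i _; rewrite sqr_ge0. Qed.

Lemma ler_coord_enorm v i : `|v 0 i| <= enorm v.
Proof.
rewrite -ler_sqr ?nnegrE ?enorm_ge0// real_normK ?num_real// enorm_sqr.
by rewrite (bigD1 i)//= lerDl sumr_ge0// => j _; rewrite sqr_ge0.
Qed.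

Lemma enorm_le_coord v c : 0 <= c -> (forall i, `|v 0 i| <= c) ->
  enorm v <= n%:R * c.
Proof.
move=> c0 vc; rewrite -ler_sqr ?nnegrE ?enorm_ge0 ?mulr_ge0// enorm_sqr.
apply: (@le_trans _ _ (\sum_(i < n) c ^+ 2)).
  by apply: ler_sum => i _; rewrite -real_normK ?num_real// lerXn2r ?nnegrE.
rewrite sumr_const card_ord exprMn -[leLHS]mulr_natl ler_wpM2r ?sqr_ge0//.
by rewrite -natrX ler_nat; case: n => // k; rewrite leq_pmulr.
Qed.

Lemma enorm0 : enorm (0 : 'rV[R]_n) = 0.
Proof. by rewrite /enorm big1 ?sqrtr0// => i _; rewrite mxE expr0n. Qed.

Lemma enormN v : enorm (- v) = enorm v.
Proof. by congr Num.sqrt; apply: eq_bigr => i _; rewrite mxE sqrrN. Qed.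

Lemma enormB x y : enorm (x - y) = enorm (y - x).
Proof. by rewrite -enormN opprB. Qed.

(** The Cauchy-Schwarz inequality, from Lagrange's identity. *)
Lemma sum_mul_le_enorm v w : \sum_i v 0 i * w 0 i <= enorm v * enorm w.
Proof.
apply: (le_trans (ler_norm _)).
rewrite -ler_sqr ?nnegrE ?mulr_ge0 ?enorm_ge0// real_normK ?num_real//.
rewrite exprMn !enorm_sqr -subr_ge0.
rewrite (_ : _ - _ = 2^-1 * \sum_i \sum_j (v 0 i * w 0 j - v 0 j * w 0 i) ^+ 2).
  by rewrite mulr_ge0 ?invr_ge0// sumr_ge0// => i _; rewrite sumr_ge0// => j _; rewrite sqr_ge0.
have -> : \sum_i \sum_j (v 0 i * w 0 j - v 0 j * w 0 i) ^+ 2 =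
    \sum_i \sum_j (v 0 i ^+ 2 * w 0 j ^+ 2) + \sum_i \sum_j (v 0 j ^+ 2 * w 0 i ^+ 2)
    - 2 * \sum_i \sum_j ((v 0 i * w 0 i) * (v 0 j * w 0 j)).
  rewrite mulr_sumr -sumrN -!big_split/=; apply: eq_bigr => i _.
  rewrite mulr_sumr -sumrN -!big_split/=; apply: eq_bigr => j _; ring.
rewrite [X in _ + X - _]exchange_big/= expr2 !mulr_suml.
have eD (F H : 'I_n -> R) :
    \sum_i \sum_j F i * H j = \sum_i F i * \sum_j H j.
  by apply: eq_bigr => i _; rewrite mulr_sumr.
rewrite !eD; lra.
Qed.

Lemma ler_enormD v w : enorm (v + w) <= enorm v + enorm w.
Proof.
rewrite -ler_sqr ?nnegrE ?addr_ge0 ?enorm_ge0// sqrrD !enorm_sqr.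
rewrite (_ : \sum_i (v + w) 0 i ^+ 2 =
  \sum_i v 0 i ^+ 2 + (\sum_i v 0 i * w 0 i) *+ 2 + \sum_i w 0 i ^+ 2).
  by rewrite lerD2r lerD2l lerMn2r sum_mul_le_enorm.
rewrite -sumrMnl -!big_split/=; apply: eq_bigr => i _.
by rewrite mxE sqrrD.
Qed.

Lemma enorm_triangle x y z : enorm (x - z) <= enorm (x - y) + enorm (y - z).
Proof. by rewrite -[x - z](subrKA y) ler_enormD. Qed.

Lemma enorm_delta (h : R) i : enorm (h *: delta_mx 0 i : 'rV[R]_n) = `|h|.
Proof.
rewrite /enorm (bigD1 i)//= big1 ?addr0 ?mxE ?eqxx ?mulr1 ?sqrtr_sqr//.
by move=> j /negPf ji; rewrite !mxE ji andbF mulr0 expr0n.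
Qed.

(** The balls of the sup norm are cubes; the next two inclusions compare them
    with the Euclidean balls. *)
Lemma subset_ball_eball x (r : R) : 0 < r -> ball x (r / n.+1%:R) `<=` eball x r.
Proof.
move=> r0 y xy; rewrite /eball/=.
have c0 : 0 < r / n.+1%:R by rewrite divr_gt0.
apply: (@le_lt_trans _ _ (n%:R * (r / n.+1%:R))).
  apply: enorm_le_coord; first exact: ltW.
  move=> i; rewrite !mxE; apply/ltW; exact: (xy.2 0 i).
by rewrite mulrCA gtr_pMr// ltr_pdivrMr// mul1r ltr_nat.
Qed.

Lemma subset_eball_ball x (r : R) : eball x r `<=` ball x r.
Proof.
move=> y xy; split; first by rewrite (le_lt_trans _ xy)// enorm_ge0.
move=> i j; rewrite ord1.
rewrite /ball/=; apply: le_lt_trans xy; rewrite (_ : _ - _ = (x - y) 0 j).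
  exact: ler_coord_enorm.
by rewrite !mxE.
Qed.

End euclidean.

Section distance.
Context {R : realType} {n : nat}.
Implicit Types (x y : 'rV[R]_n) (Omega : set 'rV[R]_n).

(** One-sided, which is equivalent by symmetry and is easier to combine with
    minima and maxima. *)
Definition lipschitz_enorm (L : R) (f : 'rV[R]_n -> R) :=
  forall x y, f x <= f y + L * enorm (x - y).

Lemma lipschitz_enorm_norm L f : lipschitz_enorm L f ->
  forall x y, `|f x - f y| <= L * enorm (x - y).
Proof.
move=> Lf x y; have := Lf x y; have := Lf y x; rewrite (enormB y x).
by rewrite ler_distl => ? ?; apply/andP; split; lra.
Qed.

Lemma lipschitz_enorm_continuous L f : lipschitz_enorm L f -> continuous f.
Proof.
move=> Lf x; apply: (proj2 (@cvgrPdist_le R R _ (nbhs x) _ f (f x))) => e e0.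
have L0 : 0 < `|L| + 1 by rewrite ltr_wpDl.
near=> y; apply: le_trans (lipschitz_enorm_norm Lf x y) _.
apply: (@le_trans _ _ ((`|L| + 1) * enorm (x - y))).
  by rewrite ler_wpM2r ?enorm_ge0// (le_trans (ler_norm _))// lerDl.
have xy : ball x (e / (`|L| + 1) / n.+1%:R) y.
  by near: y; apply: nbhsx_ballx; rewrite !divr_gt0.
have /ltW := subset_ball_eball (divr_gt0 e0 L0) xy.
by rewrite ler_pdivlMr// mulrC.
Unshelve. all: by end_near. Qed.

Lemma lipschitz_enorm_min L1 L2 f g : 0 <= L1 -> 0 <= L2 ->
  lipschitz_enorm L1 f -> lipschitz_enorm L2 g ->
  lipschitz_enorm (L1 + L2) (fun x => Num.min (f x) (g x)).
Proof.
move=> L10 L20 Lf Lg x y; rewrite mulrDl.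
have a0 := mulr_ge0 L10 (enorm_ge0 (x - y)).
have b0 := mulr_ge0 L20 (enorm_ge0 (x - y)).
have := Lf x y; have := Lg x y; rewrite /Num.min.
by case: ifPn => [|/negP]; rewrite ?ltNge; case: ifPn => //; rewrite -?leNgt; lra.
Qed.

Lemma lipschitz_enorm_max_cst L c f : 0 <= L -> lipschitz_enorm L f ->
  lipschitz_enorm L (fun x => Num.max (f x) c).
Proof.
move=> L0 Lf x y; have a0 := mulr_ge0 L0 (enorm_ge0 (x - y)).
have := Lf x y; rewrite ge_max => fxy; apply/andP; split.
  by rewrite (le_trans fxy)// lerD2r le_max lexx.
by rewrite (@le_trans _ _ (Num.max (f y) c))// ?le_max ?lexx ?orbT// lerDl.
Qed.

Context (Omega : set 'rV[R]_n).
Hypothesis OmegaNT : Omega <> setT.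
Local Notation d := (dist_compl Omega).

Let lbound0 x : lbound [set enorm (x - y) | y in ~` Omega] 0.
Proof. by move=> _ [y _ <-]; exact: enorm_ge0. Qed.

Let dist_neq0 x : [set enorm (x - y) | y in ~` Omega] !=set0.
Proof.
have /set0P[y Oy] : ~` Omega != set0.
  by apply/eqP => /(congr1 setC); rewrite setCK setC0.
by exists (enorm (x - y)), y.
Qed.

Lemma dist_compl_le x y : ~ Omega y -> d x <= enorm (x - y).
Proof. by move=> Oy; apply: ge_inf; [exists 0; exact: lbound0|exists y]. Qed.

Lemma dist_compl_ge0 x : 0 <= d x.
Proof. by apply: lb_le_inf => //; exact: lbound0. Qed.

Lemma lipschitz_dist_compl : lipschitz_enorm 1 d.
Proof.
move=> x y; rewrite mul1r -lerBlDr; apply: lb_le_inf => // _ [z Oz <-].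
by rewrite lerBlDr addrC (le_trans (dist_compl_le x Oz))// enorm_triangle.
Qed.

Lemma dist_compl0 x : ~ Omega x -> d x = 0.
Proof.
move=> Ox; apply/eqP; rewrite eq_le dist_compl_ge0 andbT.
by have := dist_compl_le x Ox; rewrite subrr enorm0.
Qed.

Lemma dist_compl_gt0 x : open Omega -> Omega x -> 0 < d x.
Proof.
move=> oO Ox; have /nbhs_ballP[e /= e0 eO] : nbhs x Omega.
  exact: open_nbhs_nbhs.
apply: (lt_le_trans e0); apply: lb_le_inf => // _ [y Oy <-].
by rewrite leNgt; apply/negP => xy; apply/Oy/eO/subset_eball_ball.
Qed.

End distance.

(** * Partial derivatives *)

Section slope.
Context {R : realType} {V : normedModType R}.
Implicit Types (f g : V -> R) (a v : V).

(** The limit that defines a partial derivative takes the default value [0] when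
    it does not exist. This makes the estimates below true at every point, so
    that no almost everywhere differentiability theorem enters the proof. *)
Lemma derive_nonderivable f a v : ~ derivable f a v -> 'D_v f a = 0.
Proof.
move=> ndf; rewrite /derive /lim /lim_in.
apply: (xgetPN 0) => l fl.
by apply: ndf; apply/cvg_ex; exists l.
Qed.

(** A one-sided bound suffices: steps [h > 0] bound the derivative from above
    and steps [h < 0] bound it from below. With [c = 0] this is Fermat's
    lemma at a maximum. *)
Lemma derive_le_slope f a v (c : R) : 0 <= c ->
  (forall h : R, f (a + h *: v) <= f a + c * `|h|) -> `|'D_v f a| <= c.
Proof.
move=> c0 fc; have [df|/derive_nonderivable ->] := pselect (derivable f a v); last first.
  by rewrite normr0.
apply/ler_addgt0Pr => e e0.
have {}df : (fun h => h^-1 *: ((f \o shift a) (h *: v) - f a)) @ 0^' --> 'D_v f a.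
  exact: df.
have /cvgrPdist_le/(_ e e0) := df.
rewrite /dnbhs /within/= => /nbhs_ballP[r /= r0 rP].
have r2 : `|r / 2| < r.
  by rewrite ger0_norm ?divr_ge0 ?ltW// ltr_pdivrMr// ltr_pMr// ltr1n.
have r20 : 0 < r / 2 by rewrite divr_gt0.
have := rP (r / 2); have := rP (- (r / 2)).
rewrite /ball/= !sub0r opprK normrN => /(_ r2) + /(_ r2).
rewrite oppr_eq0 gt_eqF//= => /(_ isT) + /(_ isT).
have := fc (r / 2); have := fc (- (r / 2)).
rewrite normrN (gtr0_norm r20) ![_ + a]addrC.
set y := f (a + - (r / 2) *: v); set z := f (a + (r / 2) *: v) => yc zc.
rewrite !ler_distl => /andP[Dy _] /andP[_ Dz].
rewrite ler_norml; apply/andP; split.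
  have : (- (r / 2))^-1 *: (y - f a) >= - c.
    rewrite /GRing.scale/= invrN mulNr lerN2 mulrC ler_pdivrMr//; lra.
  by move=> cy; rewrite opprD (le_trans _ Dy)// lerD2r.
have : (r / 2)^-1 *: (z - f a) <= c.
  rewrite /GRing.scale/= mulrC ler_pdivrMr//; lra.
by move=> zc'; rewrite (le_trans Dz)// lerD2r.
Qed.

Lemma normr_derive_opp f a v : `|'D_v (fun x => - f x) a| = `|'D_v f a|.
Proof.
have [df|ndf] := pselect (derivable f a v).
  by rewrite (_ : (fun x => - f x) = - f)// deriveN// normrN.
rewrite !derive_nonderivable// => dNf; apply: ndf.
rewrite (_ : f = - (fun x => - f x)); first exact: derivableN.
by apply/funext => x; rewrite !fctE opprK.
Qed.

Lemma derive_subc f a v (c : R) : 'D_v (fun x => f x - c) a = 'D_v f a.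
Proof.
rewrite /derive; set q := fun h : R => _; set q' := fun h : R => _.
suff -> : q = q' by [].
by apply/funext => h; rewrite /q /q' /= opprB addrA subrK.
Qed.

Lemma normr_derive_normr_subc f a v (c : R) : {for a, continuous f} ->
  f a != 0 -> `|'D_v (fun x => `|f x| - c) a| = `|'D_v f a|.
Proof.
move=> cf; rewrite derive_subc neq_lt => /orP[fa|fa].
  rewrite (@near_eq_derive _ _ _ _ (fun x => - f x)) ?normr_derive_opp//.
  have fn : \forall t \near nbhs a, f t < 0 := @cvgr_lt _ _ _ (nbhs_filter a) _ _ cf _ fa.
  apply: (@filterS _ _ (nbhs_filter a)) fn => x fx; by rewrite ltr0_norm.
rewrite (@near_eq_derive _ _ _ _ f)//.
have fn : \forall t \near nbhs a, 0 < f t := @cvgr_gt _ _ _ (nbhs_filter a) _ _ cf _ fa.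
apply: (@filterS _ _ (nbhs_filter a)) fn => x fx; by rewrite gtr0_norm.
Qed.

End slope.

Section derive_measurable.
Context {R : realType} {n : nat}.
Implicit Types (f : 'rV[R]_n -> R) (a v : 'rV[R]_n).

Lemma closed_measurable_mx (A : set 'rV[R]_n) : closed A -> measurable A.
Proof.
move=> cA; rewrite -[A]setCK; apply: measurableC; apply: open_measurable_mx.
exact: closed_openC.
Qed.

Let quot f v (h : R) a : R := h^-1 * (f (h *: v + a) - f a).

Let continuous_quot f v h : continuous f -> continuous (quot f v h).
Proof.
move=> cf.
have cs : continuous (fun x : 'rV[R]_n => h *: v + x).
  by move=> x; exact: (cvgD (cvg_cst _) cvg_id).
have cfs : continuous (fun x => f (h *: v + x)).
  by move=> x; apply: (@continuous_comp _ _ _ (fun x => h *: v + x) f); [exact: cs|exact: cf].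
by move=> x; exact: (cvgMl_tmp (cvgB (cfs x) (cf x))).
Qed.

Let punctured (m : nat) : set R := [set h : R | 0 < `|h| < m.+1%:R^-1].

(** Cauchy's criterion for the difference quotients presents the set of
    derivability as a countable combination of closed sets. *)
Let derivableE f v : [set a | derivable f a v] =
  \bigcap_k \bigcup_m \bigcap_(h in punctured m `*` punctured m)
    [set a | `|quot f v h.1 a - quot f v h.2 a| <= k.+1%:R^-1].
Proof.
apply/seteqP; split=> a.
  move=> df k _.
  have {}df : quot f v h a @[h --> 0^'] --> 'D_v f a by exact: df.
  have k0 : 0 < k.+1%:R^-1 / 2 :> R by rewrite divr_gt0.
  have /cvgrPdist_le/(_ _ k0) := df.
  rewrite /dnbhs /within/= => /nbhs_ballP[r /= r0 rP].
  have [m _ /(_ _ (leqnn m)) mr] := near_infty_natSinv_lt (PosNum r0).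
  exists m => // -[h h'] [/= /andP[h0 hm] /andP[h'0 h'm]].
  have P s : 0 < `|s| -> `|s| < m.+1%:R^-1 -> `|'D_v f a - quot f v s a| <= k.+1%:R^-1 / 2.
    move=> s0 sm; apply: rP; last by rewrite -normr_gt0.
    by rewrite /ball/= sub0r normrN (lt_trans sm).
  rewrite (splitr k.+1%:R^-1) -[quot f v h a](subrK ('D_v f a)) -addrA.
  by rewrite (le_trans (ler_normD _ _))// lerD ?P// distrC P.
move=> fa; rewrite /= /derivable; apply/cauchy_cvgP/cauchy_exP => e e0.
have [k _ /(_ _ (leqnn k)) ke] := near_infty_natSinv_lt (PosNum e0).
have [m _ mP] := fa k Logic.I.
pose h0 : R := m.+1%:R^-1 / 2.
have m0 : 0 < m.+1%:R^-1 :> R by rewrite invr_gt0.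
have h0P : punctured m h0.
  rewrite /punctured/= ger0_norm /h0 ?divr_ge0 ?ltW//.
  by rewrite divr_gt0//= ltr_pdivrMr// ltr_pMr// ltr1n.
exists (quot f v h0 a); rewrite /dnbhs /within/=.
apply/nbhs_ballP; exists m.+1%:R^-1 => //= h; rewrite /ball/= sub0r normrN => hm h0'.
apply: le_lt_trans (mP (h0, h) _) ke; split => //=.
by rewrite /punctured/= hm normr_gt0 h0'.
Qed.

Lemma measurable_derivable f v : continuous f ->
  measurable [set a | derivable f a v].
Proof.
move=> cf; rewrite derivableE; apply: bigcapT_measurable => k.
apply: bigcupT_measurable => m; apply: closed_measurable_mx.
apply: closed_bigI => -[h h'] _ /=.
have cq : continuous (fun a => `|quot f v h a - quot f v h' a|).
  have cB : continuous (fun a => quot f v h a - quot f v h' a).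
    move=> x.
    have ch := @continuous_quot f v h cf x.
    have ch' := @continuous_quot f v h' cf x.
    exact: (cvgB ch ch').
  move=> x; apply: (@continuous_comp _ _ _ (fun a => quot f v h a - quot f v h' a) Num.norm).
    exact: cB.
  exact: norm_continuous.
rewrite (_ : mkset _ = ~` ((fun a => `|quot f v h a - quot f v h' a|) @^-1`
    [set y | k.+1%:R^-1 < y])); last first.
  by apply/seteqP; split=> a /=; rewrite leNgt => /negP.
by apply: open_closedC; apply: open_comp; [move=> x _; exact: cq|exact: open_gt].
Qed.

Lemma measurable_derive f v : continuous f ->
  measurable_fun setT (fun a => 'D_v f a).
Proof.
move=> cf; have mD := measurable_derivable v cf.
rewrite -(setUv [set a | derivable f a v]).
apply/measurable_funU => //; first exact: measurableC.
split; last first.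
  apply: (@eq_measurable_fun _ _ _ _ _ (cst (0 : R))); last exact: measurable_cst.
  by move=> a; rewrite inE => nd; rewrite derive_nonderivable.
apply: (@measurable_fun_cvg _ _ _ _ (fun m a => quot f v m.+1%:R^-1 a)).
  move=> m; apply: measurable_funTS; apply: continuous_measurable_mx.
  exact: continuous_quot.
move=> a df.
have {}df : quot f v h a @[h --> 0^'] --> 'D_v f a by exact: df.
apply: (@cvg_comp _ _ _ (fun m : nat => m.+1%:R^-1 : R) (quot f v ^~ a) _ _ _ _ df).
move=> A; rewrite /dnbhs /within/= => /nbhs_ballP[r /= r0 rP].
have := near_infty_natSinv_lt (PosNum r0).
apply: filterS => m mr; apply: rP; last by rewrite gt_eqF// invr_gt0.
by rewrite /ball/= sub0r normrN ger0_norm.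
Qed.

Lemma measurable_enorm_gradient f : continuous f ->
  measurable_fun setT (fun a => enorm (gradient f a)).
Proof.
move=> cf; apply: (@measurableT_comp _ _ _ _ _ _ (@Num.sqrt R)).
  exact: continuous_measurable_fun (@sqrt_continuous R).
apply: measurable_sum => i; apply: measurable_funX.
rewrite (_ : (fun _ => _) = fun a => 'D_(delta_mx 0 i) f a).
  exact: measurable_derive.
by apply/funext => a; rewrite mxE.
Qed.

End derive_measurable.

(** * Coverings and the weak type estimate *)

Section vitali_finite.
Context {R : realType} {V : pseudoMetricType R}.
Implicit Types (i j : V * R) (s D : seq (V * R)).

Let larger i j := j.2 <= i.2.

Let larger_trans : transitive larger.
Proof. by move=> j i k ji kj; exact: le_trans kj ji. Qed.

(** Greedy selection: keep a ball of largest radius, discard the balls that it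
    meets, which its triple contains, and continue with the other ones. *)
Lemma vitali_finite s : (forall i, i \in s -> 0 < i.2) ->
  exists D, [/\ uniq D, {subset D <= s},
    trivIset [set` D] (fun i => ball i.1 i.2) &
    forall i, i \in s -> exists2 j, j \in D & ball i.1 i.2 `<=` ball j.1 (3 * j.2)].
Proof.
wlog : s / sorted larger s.
  move=> H s0; have ls : sorted larger (sort larger s).
    by apply: sort_sorted => i j; exact: le_total.
  have [i|D [uD Ds tD cD]] := H _ ls; first by rewrite mem_sort; exact: s0.
  exists D; split=> // i; first by move=> /Ds; rewrite mem_sort.
  by rewrite -(mem_sort larger); exact: cD.
have [k] := ubnP (size s); elim: k s => // k IH [|i t] /= sk ls s0.
  by exists [::]; split => // i j /=; rewrite inE.
have tri j : 0 < j.2 -> ball j.1 j.2 `<=` ball j.1 (3 * j.2).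
  by move=> j0; apply: le_ball; move: j0; lra.
pose far j := `[< ball i.1 i.2 `&` ball j.1 j.2 = set0 >].
have [| |j|D [uD Ds tD cD]] := IH (seq.filter far t).
- by rewrite size_filter (leq_ltn_trans (count_size _ _)).
- by apply: sorted_filter => //; exact: path_sorted ls.
- by rewrite mem_filter => /andP[_ jt]; apply: s0; rewrite inE jt orbT.
have Dfar j : j \in D -> far j by move=> /Ds; rewrite mem_filter => /andP[].
have i0 : 0 < i.2 by apply: s0; rewrite mem_head.
exists (i :: D); split.
- rewrite /= uD andbT; apply/negP => /Dfar/asboolP/seteqP[/(_ i.1) + _]; apply.
  by split; exact: ballxx.
- move=> j; rewrite !inE => /predU1P[->|/Ds]; first by rewrite eqxx.
  by rewrite mem_filter => /andP[_ ->]; rewrite orbT.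
- move=> j l /=; rewrite !inE => /predU1P[->|jD] /predU1P[->|lD] //.
  + by move/Dfar/asboolP : lD => -> [].
  + by move/Dfar/asboolP : jD; rewrite setIC => -> [].
  + exact: tD.
- move=> j; rewrite inE => /predU1P[->|jt]; first by exists i; [exact: mem_head|exact: tri].
  have [jfar|/asboolP/eqP/set0P[z [iz jz]]] := boolP (far j).
    have [|l lD jl] := cD j; first by rewrite mem_filter jfar.
    by exists l => //; rewrite inE lD orbT.
  exists i; first exact: mem_head.
  move=> y jy; have ji : j.2 <= i.2 by have /allP/(_ _ jt) := order_path_min larger_trans ls.
  have := ball_triangle iz (ball_triangle (ball_sym jz) jy).
  by apply: le_ball; move: ji i0; lra.
Qed.

End vitali_finite.

Section covering.
Context {R : realType} {n : nat}.
Local Notation mu := (@lebesgue_rV R n).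
Implicit Types (x : 'rV[R]_n) (A U : set 'rV[R]_n).

Lemma measurable_ball_mx x r : measurable (ball x r).
Proof. by apply: open_measurable_mx; exact: ball_open. Qed.

Lemma open_eball x r : open (eball x r).
Proof.
have ce : continuous (fun y => enorm (x - y)).
  apply: (@lipschitz_enorm_continuous _ _ 1) => y z.
  by rewrite mul1r (enormB y z) enorm_triangle.
rewrite (_ : eball x r = (fun y => enorm (x - y)) @^-1` [set t | t < r])//.
by apply: open_comp; [move=> y _; exact: ce|exact: open_lt].
Qed.

Lemma measurable_eball x r : measurable (eball x r).
Proof. by apply: open_measurable_mx; exact: open_eball. Qed.

Let cubeE x r : 0 <= r ->
  mu [set v : 'rV[R]_n | forall i, x 0 i - r <= v 0 i <= x 0 i + r] = ((2 * r) ^+ n)%:E.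
Proof.
move=> r0; rewrite (@lebesgue_rV_box _ _ (fun i => x 0 i - r) (fun i => x 0 i + r)).
  rewrite -[in RHS](card_ord n) -prodr_const; congr (_%:E).
  by apply: eq_bigr => i _; ring.
by move=> i; lra.
Qed.

Lemma lebesgue_ball_le x r : 0 <= r -> (mu (ball x r) <= ((2 * r) ^+ n)%:E)%E.
Proof.
move=> r0; rewrite -(cubeE x r0); apply: le_measure; rewrite ?inE.
- exact: measurable_ball_mx.
- exact: (measurable_box (fun i => x 0 i - r) (fun i => x 0 i + r)).
- move=> y [_ xy] i /=; have := xy 0 i; rewrite /ball/= ltr_distlC => /andP[? ?].
  by apply/andP; split; exact: ltW.
Qed.

Lemma lebesgue_eball_ge x r : 0 < r ->
  (((r / n.+1%:R) ^+ n)%:E <= mu (eball x r))%E.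
Proof.
move=> r0; have s0 : 0 < r / n.+1%:R by rewrite divr_gt0.
have h0 : 0 <= r / n.+1%:R / 2 by rewrite divr_ge0 ?ltW.
have -> : r / n.+1%:R = 2 * (r / n.+1%:R / 2) by rewrite [RHS]mulrC divfK.
rewrite -(cubeE x h0); apply: le_measure; rewrite ?inE.
- exact: (measurable_box (fun i => x 0 i - _) (fun i => x 0 i + _)).
- exact: measurable_eball.
- move=> y xy; apply: subset_ball_eball => //; split => // i j; rewrite ord1.
  rewrite /ball/= ltr_distlC; have /andP := xy j.
  move: s0; set s : R := r / _; set a : R := x 0 j; set b : R := y 0 j => s0 [ab ba].
  by apply/andP; split; lra.
Qed.

Lemma lebesgue_eball_gt0 x r : 0 < r -> (0 < mu (eball x r))%E.
Proof.
move=> r0; apply: lt_le_trans (lebesgue_eball_ge x r0).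
by rewrite lte_fin exprn_gt0// divr_gt0.
Qed.

Lemma lebesgue_eball_fin x r : 0 < r -> mu (eball x r) \is a fin_num.
Proof.
move=> r0; rewrite ge0_fin_numE//; apply: le_lt_trans (ltry ((2 * r) ^+ n)).
apply: le_trans (lebesgue_ball_le x (ltW r0)); apply: le_measure; rewrite ?inE.
- exact: measurable_eball.
- exact: measurable_ball_mx.
- exact: subset_eball_ball.
Qed.

(** The ratio between the volume [(6 r) ^ n] of the cube that contains a tripled
    ball of radius [r] and the volume [(r / n.+1) ^ n] of a cube that the ball
    contains. *)
Definition vitali_cst : R := (6 * n.+1%:R) ^+ n.

Lemma vitali_cst_gt0 : 0 < vitali_cst.
Proof. by rewrite exprn_gt0// mulr_gt0. Qed.

Lemma lebesgue_ball3_le x r : 0 < r ->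
  (mu (ball x (3 * r)) <= vitali_cst%:E * mu (eball x r))%E.
Proof.
move=> r0; apply: (le_trans (lebesgue_ball_le x _)); first by rewrite mulr_ge0 ?ltW.
apply: (@le_trans _ _ (vitali_cst%:E * ((r / n.+1%:R) ^+ n)%:E)%E).
  rewrite -EFinM lee_fin -exprMn.
  by rewrite (_ : _ * (r / _) = 2 * (3 * r))// -mulrA [_ * (r / _)]mulrC divfK ?pnatr_eq0//; ring.
by rewrite lee_pmul2l ?lte_fin ?vitali_cst_gt0// lebesgue_eball_ge.
Qed.

End covering.

Section exhaustion.
Context {d : measure_display} {T : measurableType d} {R : realType}.
Variable mu : {measure set T -> \bar R}.
Local Open Scope ereal_scope.

Lemma measure_exhaustion_le (A : set T) (F : nat -> set T) (c : R) (b : \bar R) :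
  measurable A -> (forall k, measurable (F k)) ->
  (forall k l, (k <= l)%N -> F k `<=` F l) -> A `<=` \bigcup_k F k ->
  (forall k, c%:E * mu (A `&` F k) <= b) -> c%:E * mu A <= b.
Proof.
move=> mA mF ndF AF Fb.
have -> : A = \bigcup_k (A `&` F k).
  by rewrite -setI_bigcupr; apply/esym/setIidPl.
apply: (@cvge_le _ \oo _ R (fun k => c%:E * mu (A `&` F k))).
  by apply: nearW => k; exact: Fb.
apply: cvgeZl => //; apply: nondecreasing_cvg_mu.
- by move=> k; exact: measurableI.
- by apply: bigcupT_measurable => k; exact: measurableI.
- by move=> k l kl; apply/subsetPset; apply: setIS; exact: ndF.
Qed.

Lemma integral_exhaustion_le (D : set T) (F : nat -> set T) (f : T -> \bar R) (b : \bar R) :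
  measurable D -> (forall k, measurable (F k)) ->
  (forall k l, (k <= l)%N -> F k `<=` F l) -> D `<=` \bigcup_k F k ->
  measurable_fun D f -> (forall x, D x -> 0 <= f x) ->
  (forall k, \int[mu]_(x in D `&` F k) f x <= b) -> \int[mu]_(x in D) f x <= b.
Proof.
move=> mD mF ndF DF mf f0 Fb.
have -> : D = \bigcup_k (D `&` F k).
  by rewrite -setI_bigcupr; apply/esym/setIidPl.
apply: (@cvge_le _ \oo _ R (fun k => \int[mu]_(x in D `&` F k) f x)).
  by apply: nearW => k; exact: Fb.
apply: ge0_nondecreasing_set_cvg_integral.
- by move=> k l kl; apply/subsetPset; apply: setIS; exact: ndF.
- by move=> k; exact: measurableI.
- by move=> k; apply: measurable_funS mf => //; exact: subIsetl.
- by move=> k x [Dx _]; exact: f0.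
Qed.

Lemma measure_seq_cover_le (I : eqType) (B : I -> set T) (s : seq I) (A : set T) :
  measurable A -> (forall i, measurable (B i)) ->
  (forall x, A x -> exists2 i, i \in s & B i x) ->
  mu A <= \sum_(i <- s) mu (B i).
Proof.
move=> + mB; elim: s A => [|i s IH] A mA As.
  rewrite big_nil (_ : A = set0) ?measure0//.
  by apply/seteqP; split=> // x /As[].
rewrite big_cons -(setUIDK A (B i)) (le_trans (measureU2 _ _ _))//.
- exact: measurableI.
- exact: measurableD.
- apply: leeD; first by apply: le_measure; rewrite ?inE//; exact: measurableI.
  apply: IH; first exact: measurableD.
  move=> x [Ax nBx]; have [j] := As x Ax.
  by rewrite inE => /predU1P[->//|js Bj]; exists j.
Qed.

Lemma integral_seq_cover_le (I : eqType) (B : I -> set T) (s : seq I) (A : set T)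
    (f : T -> \bar R) :
  measurable A -> (forall i, measurable (B i)) -> measurable_fun setT f ->
  (forall x, 0 <= f x) -> (forall x, A x -> exists2 i, i \in s & B i x) ->
  \int[mu]_(x in A) f x <= \sum_(i <- s) \int[mu]_(x in B i) f x.
Proof.
move=> + mB mf f0; elim: s A => [|i s IH] A mA As.
  rewrite big_nil (_ : A = set0) ?integral_set0//.
  by apply/seteqP; split=> // x /As[].
rewrite big_cons -(setUIDK A (B i)) ge0_integral_setU//; last 4 first.
- exact: measurableI.
- exact: measurableD.
- exact: measurable_funTS.
- by apply/disj_setPS => x [[_ Bx] [_ nBx]].
apply: leeD.
  by apply: ge0_subset_integral => //; [exact: measurableI|exact: measurable_funTS].
apply: IH; first exact: measurableD.
move=> x [Ax nBx]; have [j] := As x Ax.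
by rewrite inE => /predU1P[->//|js Bj]; exists j.
Qed.

Lemma integral_support (U W : set T) (f : T -> \bar R) :
  (forall x, U x -> ~ W x -> f x = 0) ->
  \int[mu]_(x in U) f x = \int[mu]_(x in U `&` W) f x.
Proof.
move=> fW; rewrite integral_mkcondr; apply: eq_integral => x.
rewrite inE => Ux; rewrite /patch; case: ifPn => //.
by rewrite notin_setE => nWx; exact: fW.
Qed.

End exhaustion.

Section maximal_weak_type.
Context {R : realType} {n : nat}.
Local Notation mu := (@lebesgue_rV R n).
Local Open Scope ereal_scope.
Implicit Types (A U : set 'rV[R]_n) (g : 'rV[R]_n -> \bar R).

(** The weak type estimate for the maximal function. Countably many of the
    concentric cubes cover [A], and a finite number of them suffices up to a
    passage to the limit. Among these the Vitali lemma selects disjoint cubes;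
    the Euclidean balls inside them are disjoint as well, and their volumes are
    comparable to those of the cubes. *)
Lemma maximal_weak_type A U g (c : R) :
  measurable A -> measurable U -> measurable_fun setT g ->
  (forall x, 0 <= g x) -> (0 <= c)%R ->
  (forall x, A x -> exists r : R, [/\ (0 < r)%R, eball x r `<=` U &
     c%:E * mu (eball x r) <= \int[mu]_(y in eball x r) g y]) ->
  c%:E * mu A <= (vitali_cst (R := R) (n := n))%:E * \int[mu]_(y in U) g y.
Proof.
move=> mA mU mg g0 c0 Hc; set K := vitali_cst.
have /choice[r rP] : forall x, exists r : R, A x -> [/\ (0 < r)%R, eball x r `<=` U &
     c%:E * mu (eball x r) <= \int[mu]_(y in eball x r) g y].
  move=> x; have [Ax|nAx] := pselect (A x); last by exists 0%R.
  by have [s] := Hc x Ax; exists s.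
(* Lindelof: one cube is chosen for each rational box that some cube contains *)
have /choice[sel selP] : forall k, exists o0 : option 'rV[R]_n,
    (forall x, o0 = Some x -> A x) /\
    (forall (q : 'rV[rat]_n * nat) x, unpickle k = Some q -> A x ->
      rat_box q.1 q.2 `<=` ball x (r x) ->
      exists2 y, o0 = Some y & rat_box q.1 q.2 `<=` ball y (r y)).
  move=> k.
  have [[q [x [kq Ax qx]]]|no] := pselect (exists (q : 'rV[rat]_n * nat) x,
      [/\ unpickle k = Some q, A x & rat_box q.1 q.2 `<=` ball x (r x)]).
    exists (Some x); split=> [_ [<-]//|q' x' kq' _ _]; exists x => //.
    by move: kq; rewrite kq' => -[->].
  by exists None; split=> // q x kq Ax qx; exfalso; apply: no; exists q, x.
pose s N := [seq (x, r x) | x <- pmap sel (iota 0 N)].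
have sA N i : i \in s N -> A i.1 /\ i.2 = r i.1.
  move=> /mapP[x + ->] /=; rewrite mem_pmap => /mapP[k _ /esym selk].
  by split => //; exact: (selP k).1.
pose F N := [set x : 'rV[R]_n | exists2 i, i \in s N & ball i.1 i.2 x].
have FE N : F N = \bigcup_(i in [set` s N]) ball i.1 i.2.
  by apply/seteqP; split=> x [i si ix]; exists i.
apply: (@measure_exhaustion_le _ _ _ _ _ F) => //.
- move=> N; rewrite FE bigcup_seq; apply: bigsetU_measurable => i _.
  exact: measurable_ball_mx.
- move=> k l kl x [_ /mapP[y + ->] yx]; rewrite mem_pmap => yk.
  exists (y, r y) => //; apply/mapP; exists y => //; rewrite mem_pmap.
  case/mapP: yk => m; rewrite mem_iota => mk ->; apply/map_f.
  by rewrite mem_iota (leq_trans _ kl)//.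
- move=> x Ax; have [r0 _ _] := rP x Ax.
  have := open_bigcup_rat_box (ball_open x (r x)).
  move=> /seteqP[+ _] => /(_ x (ballxx x r0))[q /= qx xq].
  have [y sely qy] := (selP (pickle q)).2 q x (pickleK q) Ax qx.
  exists (pickle q).+1 => //; exists (y, r y); last exact: qy.
  apply/mapP; exists y => //; rewrite mem_pmap -sely; apply: map_f.
  by rewrite mem_iota /=.
move=> N; have s0 i : i \in s N -> (0 < i.2)%R.
  by move=> /sA[Ai ->]; have [] := rP _ Ai.
have [D [uD Ds tD cD]] := vitali_finite s0.
have D0 i : i \in D -> (0 < i.2)%R by move/Ds/s0.
have DP i : i \in D -> eball i.1 i.2 `<=` U /\
    c%:E * mu (eball i.1 i.2) <= \int[mu]_(y in eball i.1 i.2) g y.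
  by move=> /Ds/sA[Ai ->]; have [] := rP _ Ai.
have mAF : measurable (A `&` F N).
  apply: measurableI => //; rewrite FE bigcup_seq.
  by apply: bigsetU_measurable => i _; exact: measurable_ball_mx.
have cov : mu (A `&` F N) <= \sum_(i <- D) mu (ball i.1 (3 * i.2)).
  apply: measure_seq_cover_le => //; first by move=> i; exact: measurable_ball_mx.
  by move=> x [_ [i /cD[j jD ij] ix]]; exists j => //; exact: ij.
apply: (le_trans (lee_wpmul2l _ cov)); first by rewrite lee_fin.
rewrite ge0_sume_distrr//.
apply: (@le_trans _ _ (\sum_(i <- D) K%:E * \int[mu]_(y in eball i.1 i.2) g y)).
  rewrite big_seq [leRHS]big_seq; apply: lee_sum => i iD.
  apply: (le_trans (lee_wpmul2l _ (lebesgue_ball3_le _ (D0 i iD)))); first by rewrite lee_fin.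
  rewrite muleCA; apply: lee_wpmul2l; first by rewrite lee_fin ltW// vitali_cst_gt0.
  exact: (DP i iD).2.
rewrite -ge0_sume_distrr; last by move=> i _; apply: integral_ge0.
apply: lee_wpmul2l; first by rewrite lee_fin ltW// vitali_cst_gt0.
rewrite -(@ge0_integral_bigsetU _ _ _ _ _ (fun i => eball i.1 i.2))//.
- apply: ge0_subset_integral => //.
  + by apply: bigsetU_measurable => i _; exact: measurable_eball.
  + exact: measurable_funTS.
  + by rewrite -bigcup_seq => x [i /= iD ix]; exact: (DP i iD).1.
- by move=> i; exact: measurable_eball.
- move=> i j iD jD [x [ix jx]]; apply: tD => //; exists x.
  by split; exact: subset_eball_ball.
- exact: measurable_funTS.
Qed.

End maximal_weak_type.

(** * Truncated test functions *)

Section test_function.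
Context {R : realType} {n : nat}.
Implicit Types (u eta ell : 'rV[R]_n -> R) (x y : 'rV[R]_n) (t : R).

(** The function [|u|] truncated at the levels [t] and [2 t], and then cut off.
    Taking a minimum with [t * eta] instead of multiplying by [eta] leaves at
    every point a single function to differentiate, so that no product rule is
    needed. *)
Definition test_function u eta t x : R :=
  Num.min (Num.min (Num.max (`|u x| - t) 0) t) (t * eta x).

(** The bound in [cutoff_slope] is one-sided and concerns only the points where
    [eta] is positive: this is what [derive_le_slope] asks for. It lets
    [ell] depend on the point without any differentiation of [eta]. *)
Record cutoff eta ell : Prop := Cutoff {
  cutoff_ge0 : forall x, 0 <= eta x ;
  cutoff_le1 : forall x, eta x <= 1 ;
  cutoff_lip : exists2 L, 0 <= L & lipschitz_enorm L eta ;
  cutoff_slope_ge0 : forall x, 0 <= ell x ;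
  cutoff_slope : forall x y, 0 < eta x -> eta y <= eta x + ell x * enorm (y - x)
}.

Lemma cutoff_continuous eta ell : cutoff eta ell -> continuous eta.
Proof. by move=> [_ _ [L _ Le] _ _]; exact: lipschitz_enorm_continuous Le. Qed.

Lemma cutoff1 : cutoff (cst 1) (cst 0).
Proof.
split=> //=; first by exists 0 => // x y /=; rewrite mul0r addr0.
by move=> x y _; rewrite mul0r addr0.
Qed.

Variables (u eta ell : 'rV[R]_n -> R).
Hypothesis ceta : cutoff eta ell.
Local Notation v := (test_function u eta).

Let teta_ge0 t x : 0 < t -> 0 <= t * eta x.
Proof. by move=> t0; apply: mulr_ge0; [exact: ltW|exact: cutoff_ge0 ceta x]. Qed.

Let teta_le t x : 0 < t -> t * eta x <= t.
Proof. by move=> t0; rewrite ger_pMr// (cutoff_le1 ceta). Qed.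

Lemma test_function_ge0 t x : 0 < t -> 0 <= v t x.
Proof. by move=> t0; rewrite !le_min le_max lexx orbT ltW//= teta_ge0. Qed.

Lemma test_function_le t x : v t x <= t * eta x.
Proof. by rewrite /test_function ge_min lexx orbT. Qed.

Lemma test_function_eqt t x : 0 < t -> eta x = 1 -> 2 * t <= `|u x| -> v t x = t.
Proof.
move=> t0 e1 ux; rewrite /test_function e1 mulr1 [Num.max _ _]max_l; last by lra.
by rewrite (@min_r _ _ (`|u x| - t) t) ?minxx//; lra.
Qed.

Lemma test_function0 t x : 0 < t -> `|u x| <= t -> v t x = 0.
Proof.
move=> t0 ux; rewrite /test_function [Num.max _ _]max_r; last by lra.
by rewrite (@min_l _ _ 0 t) ?ltW// min_l// teta_ge0.
Qed.

Lemma test_function_Lip0 (Omega : set 'rV[R]_n) t : 0 < t ->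
  Lip0 Omega u -> Lip0 Omega (v t).
Proof.
move=> t0 [[L Lu] u0]; split; last first.
  by move=> x /u0 ux; apply: test_function0 => //; rewrite ux normr0 ltW.
have [Le Le0 leta] := cutoff_lip ceta.
have L'0 : 0 <= `|L| by [].
have Labs : lipschitz_enorm `|L| (fun x => `|u x| - t).
  move=> x y; have := Lu x y; have := lerB_dist (u x) (u y).
  have : L * enorm (x - y) <= `|L| * enorm (x - y).
    by rewrite ler_wpM2r ?enorm_ge0// ler_norm.
  by lra.
have Lcst : lipschitz_enorm 0 (fun _ : 'rV[R]_n => t).
  by move=> x y; rewrite mul0r addr0.
have Lteta : lipschitz_enorm (t * Le) (fun x => t * eta x).
  by move=> x y; rewrite -mulrA -mulrDr ler_wpM2l// ltW.
have tLe : 0 <= t * Le by rewrite mulr_ge0// ltW.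
have Lmin := lipschitz_enorm_min L'0 (lexx 0)
  (@lipschitz_enorm_max_cst _ _ _ 0 _ L'0 Labs) Lcst.
have L''0 : 0 <= `|L| + 0 by rewrite addr0.
eexists; exact: lipschitz_enorm_norm (lipschitz_enorm_min L''0 tLe Lmin Lteta).
Qed.

(** Maz'ya's truncation: the gradient of a test function only sees [u] between
    the levels [t] and [2 t], and the cutoff above the level [t]. *)
Lemma test_function_gradient t x : 0 < t -> continuous u ->
  enorm (gradient (v t) x) = 0 \/
  [/\ 0 < eta x, t < `|u x| &
    enorm (gradient (v t) x) <= n%:R * (t * ell x) \/
    (`|u x| < 2 * t /\ enorm (gradient (v t) x) = enorm (gradient u x))].
Proof.
move=> t0 cu.
have le0_grad c : 0 <= c -> (forall y, v t y <= v t x + c * enorm (y - x)) ->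
    enorm (gradient (v t) x) <= n%:R * c.
  move=> c0 vc; apply: enorm_le_coord => // i; rewrite mxE.
  apply: derive_le_slope => // h; apply: (le_trans (vc _)).
  by rewrite addrAC subrr add0r enorm_delta.
(* where v vanishes it has a minimum, so that its partial derivatives vanish *)
have min_grad : v t x = 0 -> enorm (gradient (v t) x) = 0.
  move=> vx; apply/eqP; rewrite eq_le enorm_ge0 andbT -(mulr0 n%:R).
  apply: enorm_le_coord => // i; rewrite mxE -normr_derive_opp.
  apply: derive_le_slope => // h.
  by rewrite mul0r addr0 vx oppr0 oppr_le0 test_function_ge0.
have [ux|ux] := leP `|u x| t; first by left; apply: min_grad; exact: test_function0.
have [ex|ex] := leP (eta x) 0.
  left; apply: min_grad; apply/eqP; rewrite eq_le test_function_ge0// andbT.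
  rewrite (le_trans (test_function_le t x))// pmulr_rle0//.
right; split => //.
have [tx|tx] := leP (t * eta x) (`|u x| - t).
  left; have vx : v t x = t * eta x.
    rewrite /test_function min_r// le_min teta_le// andbT le_max tx//.
  apply: le0_grad; first by apply: mulr_ge0; [exact: ltW|exact: cutoff_slope_ge0 ceta x].
  move=> y; rewrite vx -mulrA -mulrDr (le_trans (test_function_le t y))//.
  by rewrite ler_pM2l//; exact: cutoff_slope ceta _ _ ex.
right; have u2t : `|u x| < 2 * t by have := teta_le x t0; lra.
split => //.
have ceta' := cutoff_continuous ceta.
have cabs : {for x, continuous (fun y => `|u y|)}.
  by apply: continuous_comp; [exact: cu|exact: norm_continuous].
have cdiff : {for x, continuous (fun y => t * eta y - (`|u y| - t))}.
  have := cvgB (cvgMl_tmp (ceta' x) : t * eta y @[y --> x] --> t * eta x)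
     (cvgB cabs (cvg_cst t)).
  exact.
have nv : \forall y \near nbhs x, v t y = `|u y| - t.
  have n1 : \forall y \near nbhs x, `|u y| < 2 * t :=
    @cvgr_lt _ _ _ (nbhs_filter x) _ _ cabs _ u2t.
  have n2 : \forall y \near nbhs x, t < `|u y| :=
    @cvgr_gt _ _ _ (nbhs_filter x) _ _ cabs _ ux.
  have tx' : 0 < t * eta x - (`|u x| - t) by rewrite subr_gt0.
  have n3 : \forall y \near nbhs x, 0 < t * eta y - (`|u y| - t) :=
    @cvgr_gt _ _ _ (nbhs_filter x) _ _ cdiff _ tx'.
  near=> y.
  have y1 : `|u y| < 2 * t by near: y.
  have y2 : t < `|u y| by near: y.
  have y3 : 0 < t * eta y - (`|u y| - t) by near: y.
  rewrite /test_function [Num.max _ _]max_l; last by lra.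
  by rewrite (@min_l _ _ (`|u y| - t) t) ?min_l//; lra.
have ux0 : u x != 0 by rewrite -normr_gt0 (lt_trans t0).
have dE i : `|'D_(delta_mx 0 i) (v t) x| = `|'D_(delta_mx 0 i) u x|.
  by rewrite (near_eq_derive _ nv) normr_derive_normr_subc//; exact: cu.
rewrite /enorm; congr Num.sqrt; apply: eq_bigr => i _.
by rewrite !mxE -[LHS]real_normK ?num_real// dE real_normK ?num_real.
Unshelve. all: by end_near. Qed.

End test_function.

(** Concavity of the logarithm. *)
Lemma ln_increment_le (R : realType) (r s : R) : 0 < r -> 0 < s -> ln s <= ln r + (s - r) / r.
Proof.
move=> r0 s0; have r0' : r != 0 by rewrite gt_eqF.
have -> : s = r * (1 + (s - r) / r).
  by rewrite mulrDr mulr1 mulrC divfK// addrC subrK.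
have e : 1 + (s - r) / r = s / r by rewrite mulrBl divff// addrC subrK.
have sr0 : 0 < s / r by rewrite divr_gt0.
rewrite e lnM ?posrE// lerD2l [r * _]mulrC divfK// -e le_ln1Dx//.
by rewrite -subr_gt0 opprK addrC e.
Qed.

Section log_cutoff.
Context {R : realType} {n : nat}.
Implicit Types (x y : 'rV[R]_n).
Variables (d : 'rV[R]_n -> R) (a M : R).

(** Grows from [0] where [d <= a] to [1] where [d >= a * expR M]. On this range
    its slope is [(M * d)^-1], smaller by the factor [M] than that of a cutoff
    supported in one layer. *)
Definition log_cutoff x : R := Num.min (ln (Num.max (d x / a) 1) / M) 1.

Definition log_cutoff_slope x : R :=
  if log_cutoff x < 1 then (M * d x)^-1 else 0.

Hypotheses (d1 : lipschitz_enorm 1 d) (d0 : forall x, 0 <= d x).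
Hypotheses (a0 : 0 < a) (M0 : 0 < M).

Lemma log_cutoff_gt0 x : 0 < log_cutoff x -> a < d x.
Proof.
rewrite lt_min => /andP[+ _]; apply: contraTT; rewrite -!leNgt => da.
by rewrite max_r ?ln1 ?mul0r// ler_pdivrMr// mul1r.
Qed.

Lemma log_cutoff_lt1 x : log_cutoff x < 1 -> d x < a * expR M.
Proof.
apply: contraTT; rewrite -!leNgt => da.
have dxa : expR M <= d x / a by rewrite ler_pdivlMr// mulrC.
rewrite le_min lexx andbT ler_pdivlMr// mul1r -(expRK M) ler_ln ?posrE ?expR_gt0//.
  by rewrite le_max dxa.
by rewrite lt_max ltr01 orbT.
Qed.

Lemma log_cutoff_eq1 x : a * expR M <= d x -> log_cutoff x = 1.
Proof.
move=> adx; apply/eqP; rewrite eq_le ge_min lexx orbT/= leNgt.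
by apply/negP => /log_cutoff_lt1; rewrite ltNge adx.
Qed.

Let w x := Num.max (d x / a) 1.

Let w1 x : 1 <= w x. Proof. by rewrite le_max lexx orbT. Qed.

Let w0 x : 0 < w x. Proof. exact: lt_le_trans (w1 x). Qed.

Let wlip : lipschitz_enorm a^-1 w.
Proof.
apply: lipschitz_enorm_max_cst; first by rewrite invr_ge0 ltW.
move=> x y; have := d1 x y; rewrite mul1r => dxy.
by rewrite [a^-1 * _]mulrC -mulrDl ler_pM2r ?invr_gt0.
Qed.

Let ln_w x y : ln (w y) <= ln (w x) + a^-1 * enorm (y - x) / w x.
Proof.
apply: (le_trans (ln_increment_le (w0 x) (w0 y))); rewrite lerD2l ler_pM2r ?invr_gt0//.
by rewrite lerBlDr addrC; exact: wlip.
Qed.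

Lemma log_cutoff_cutoff : cutoff log_cutoff log_cutoff_slope.
Proof.
have M1 : 0 < M^-1 by rewrite invr_gt0.
have a1 : 0 < a^-1 by rewrite invr_gt0.
have step x y : ln (w y) / M <= ln (w x) / M + M^-1 * (a^-1 * enorm (y - x) / w x).
  by rewrite [M^-1 * _]mulrC -mulrDl ler_pM2r.
split.
- move=> x; rewrite le_min ler01 andbT; apply: divr_ge0; last exact: ltW.
  by apply: ln_ge0; exact: w1.
- by move=> x; rewrite ge_min lexx orbT.
- exists (M^-1 * a^-1 + 0); first by rewrite addr0 mulr_ge0 ?ltW.
  apply: lipschitz_enorm_min => //; first by rewrite mulr_ge0 ?ltW.
    move=> x y; apply: (le_trans (step y x)).
    rewrite lerD2l -[leRHS]mulrA ler_pM2l// ler_pdivrMr//.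
    by rewrite ler_peMr// mulr_ge0 ?enorm_ge0 ?ltW.
  by move=> x y; rewrite mul0r addr0.
- by move=> x; rewrite /log_cutoff_slope; case: ifP => // _; rewrite invr_ge0 mulr_ge0 ?(ltW M0).
- move=> x y ex; have ax := log_cutoff_gt0 ex.
  have dx0 : 0 < d x := lt_trans a0 ax.
  rewrite /log_cutoff_slope; case: ifPn => [e1|]; last first.
    rewrite -leNgt => e1; rewrite mul0r addr0 (le_trans _ e1)//.
    by rewrite /log_cutoff ge_min lexx orbT.
  have wx : w x = d x / a by rewrite /w max_l// ler_pdivlMr// mul1r ltW.
  have -> : log_cutoff x = ln (w x) / M.
    by move: e1; rewrite /log_cutoff -/(w x) /Num.min; case: ifP => //; rewrite ltxx.
  rewrite {1}/log_cutoff -/(w y) ge_min; apply/orP; left.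
  rewrite (_ : _^-1 * _ = M^-1 * (a^-1 * enorm (y - x) / w x)); first exact: step.
  by rewrite wx; field; rewrite !gt_eqF.
Qed.

End log_cutoff.

(** * Layers of the distance function *)

Section layers.
Context {R : realType} {n : nat}.
Local Notation mu := (@lebesgue_rV R n).
Variable Omega : set 'rV[R]_n.
Local Notation d := (dist_compl Omega).
Implicit Types (x y : 'rV[R]_n) (m i j : int).

Definition layer m := [set x | expR (m%:~R - 1) < d x <= expR m%:~R].

(** It contains the balls with centre [x] in the layer [m] and radius less than
    [2 * d x]. *)
Definition tube m := [set x | d x < 3 * expR m%:~R].

Lemma layer_index_le i j x : layer i x -> d x <= expR j%:~R -> (i <= j)%R.
Proof.
move=> /andP[+ _] dx => /lt_le_trans/(_ dx); rewrite ltr_expR.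
by rewrite -[1]/(1%:~R) -rmorphB/= ltr_int; lia.
Qed.

Lemma layer_index_gt i j x : layer i x -> expR j%:~R < d x -> (j < i)%R.
Proof. by move=> /andP[_ dx] /lt_le_trans/(_ dx); rewrite ltr_expR ltr_int. Qed.

Lemma trivIset_layer : trivIset setT layer.
Proof.
move=> i j _ _ [x [ix jx]]; apply/eqP; rewrite eq_le.
case/andP: (ix) => _ ix2; case/andP: (jx) => _ jx2.
by rewrite (layer_index_le ix jx2) (layer_index_le jx ix2).
Qed.

Hypothesis OmegaNT : Omega <> setT.

Lemma continuous_dist_compl : continuous d.
Proof. exact: lipschitz_enorm_continuous (lipschitz_dist_compl OmegaNT). Qed.

Lemma measurable_preimage_dist (D : set R) : measurable D -> measurable (d @^-1` D).
Proof.
move=> mD; rewrite -[X in measurable X]setTI.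
by apply: continuous_measurable_mx => //; exact: continuous_dist_compl.
Qed.

Lemma measurable_layer m : measurable (layer m).
Proof.
rewrite (_ : layer m = d @^-1` `]expR (m%:~R - 1), expR m%:~R]%classic).
  exact: measurable_preimage_dist.
by apply/seteqP; split=> x /=; rewrite in_itv.
Qed.

Lemma measurable_tube m : measurable (tube m).
Proof.
rewrite (_ : tube m = d @^-1` `]-oo, 3 * expR m%:~R[%classic).
  exact: measurable_preimage_dist.
by apply/seteqP; split=> x /=; rewrite in_itv.
Qed.

Lemma layer_subset m : layer m `<=` Omega.
Proof.
move=> x /andP[+ _]; apply: contraPP => /(dist_compl0 OmegaNT) ->.
by rewrite ltNge expR_ge0.
Qed.

Hypothesis oOmega : open Omega.

Let mOmega : measurable Omega. Proof. exact: open_measurable_mx. Qed.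

Lemma layer_cover x : Omega x -> exists m, layer m x.
Proof.
move=> /(dist_compl_gt0 OmegaNT oOmega) dx; exists (Num.ceil (ln (d x))).
have /andP[h1 h2] := ceil_itv (ln (d x)).
apply/andP; split.
  by rewrite -[ltRHS]lnK ?posrE// ltr_expR; move: h1; rewrite rmorphB.
by rewrite -[leLHS]lnK ?posrE// ler_expR.
Qed.

Lemma layer_ln m x : layer m x -> m%:~R - 1 < ln (d x) <= m%:~R.
Proof.
move=> mx; have /(dist_compl_gt0 OmegaNT oOmega) dx := layer_subset mx.
case/andP: mx => mx1 mx2; apply/andP; split.
  by rewrite -ltr_expR lnK ?posrE.
by rewrite -ler_expR lnK ?posrE.
Qed.

Lemma layer_powR m x s : layer m x ->
  expR (- `|s|) * expR (s * m%:~R) <= d x `^ s <= expR `|s| * expR (s * m%:~R).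
Proof.
move=> mx; have /andP[l1 l2] := layer_ln mx.
have /(dist_compl_gt0 OmegaNT oOmega) dx := layer_subset mx.
rewrite /powR gt_eqF// -!expRD !ler_expR.
have : `|s * (ln (d x) - m%:~R)| <= `|s|.
  rewrite normrM ler_piMr// ler_norml; apply/andP; split; lra.
by rewrite ler_norml mulrBr => /andP[? ?]; apply/andP; split; lra.
Qed.

Lemma sum_layer_le (f : 'rV[R]_n -> R) (a : int) L :
  measurable_fun setT (EFin \o f) -> (forall x, 0 <= f x) ->
  (\sum_(i < L) \int[mu]_(x in layer (a + i%:Z)) (f x)%:E <=
   \int[mu]_(x in Omega) (f x)%:E)%E.
Proof.
move=> mf f0.
rewrite -(@ge0_integral_bigsetU _ _ _ mu _ (fun i : 'I_L => layer (a + i%:Z)))//.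
- apply: ge0_subset_integral => //.
  + by apply: bigsetU_measurable => i _; exact: measurable_layer.
  + exact: measurable_funTS.
  + by move=> x _; rewrite lee_fin.
  + by rewrite -bigcup_seq => x [i _]; exact: layer_subset.
- by move=> i; exact: measurable_layer.
- exact: index_enum_uniq.
- move=> i j _ _ ij; apply/val_inj; have /addrI := trivIset_layer I I ij.
  by move=> [].
- exact: measurable_funTS.
- by move=> x _; rewrite lee_fin.
Qed.

Lemma integral_le_sum_layer (f : 'rV[R]_n -> R) (b : \bar R) :
  measurable_fun setT (EFin \o f) -> (forall x, 0 <= f x) ->
  (forall (a : int) L, (\sum_(i < L) \int[mu]_(x in layer (a + i%:Z)) (f x)%:E <= b)%E) ->
  (\int[mu]_(x in Omega) (f x)%:E <= b)%E.
Proof.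
move=> mf f0 fb.
pose P N := [set x | expR (- N%:R) < d x <= expR N%:R].
have mP N : measurable (P N).
  rewrite (_ : P N = d @^-1` `]expR (- N%:R), expR N%:R]%classic).
    exact: measurable_preimage_dist.
  by apply/seteqP; split=> x /=; rewrite in_itv.
apply: (@integral_exhaustion_le _ _ _ mu _ P) => //.
- move=> k l kl x /andP[k1 k2]; apply/andP; split.
    by apply: le_lt_trans k1; rewrite ler_expR lerN2 ler_nat.
  by apply: (le_trans k2); rewrite ler_expR ler_nat.
- move=> x Ox; have dx := dist_compl_gt0 OmegaNT oOmega Ox.
  exists (Num.truncn `|ln (d x)|).+1 => //.
  have := truncnS_gt `|ln (d x)|; rewrite ltr_norml => /andP[l1 l2].
  apply/andP; split; first by rewrite -[ltRHS]lnK ?posrE// ltr_expR.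
  by rewrite -[leLHS]lnK ?posrE// ler_expR ltW.
- exact: measurable_funTS.
- by move=> x _; rewrite lee_fin.
move=> N; apply: le_trans (fb (- N%:Z) (N + N).+1).
apply: integral_seq_cover_le => //.
- exact: measurableI.
- by move=> k; exact: measurable_layer.
- move=> x [Ox /andP[x1 x2]]; have [j jx] := layer_cover Ox.
  have j1 : j <= N%:Z by apply: (layer_index_le jx); rewrite -pmulrn.
  have j2 : - N%:Z < j by apply: (layer_index_gt jx); rewrite rmorphN/= -pmulrn.
  have kM : (absz (j + N%:Z)%R < (N + N).+1)%N by lia.
  exists (Ordinal kM); first by rewrite mem_index_enum.
  by rewrite /= (_ : _ + _ = j)//; lia.
Qed.

End layers.

(** * The Hardy inequality on one layer *)

Section pointwise_to_weak.
Context {R : realType} {n : nat}.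
Local Notation mu := (@lebesgue_rV R n).
Variables (p beta C : R) (Omega : set 'rV[R]_n).
Local Notation d := (dist_compl Omega).
Local Notation layer := (layer Omega).
Local Notation tube := (tube Omega).
Implicit Types (u v : 'rV[R]_n -> R) (x y : 'rV[R]_n) (m : int).

Definition energy u x : R := enorm (gradient u x) `^ p * d x `^ beta.

Definition hardy_term u x : R := `|u x| `^ p * d x `^ (beta - p).

Definition pointwise_hardy :=
  forall (u : 'rV[R]_n -> R) (x : 'rV[R]_n), Omega x -> Lip0 Omega u ->
    (`|u x|%:E <= (C * d x `^ (1 - beta / p))%:E *
      (restricted_maximal (2 * d x) (energy u) x) `^ (1 / p))%E.

Hypotheses (p1 : 1 < p) (OmegaNT : Omega <> setT) (oOmega : open Omega).

Lemma energy_ge0 u x : 0 <= energy u x.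
Proof. by rewrite mulr_ge0 ?powR_ge0. Qed.

Lemma hardy_term_ge0 u x : 0 <= hardy_term u x.
Proof. by rewrite mulr_ge0 ?powR_ge0. Qed.

Lemma Lip0_continuous u : Lip0 Omega u -> continuous u.
Proof.
move=> [[L Lu] _]; apply: (@lipschitz_enorm_continuous _ _ L) => x y.
by have := Lu x y; rewrite ler_distl => /andP[_]; rewrite addrC.
Qed.

Lemma measurable_dist_powR s : measurable_fun setT (fun x => d x `^ s).
Proof.
apply: (measurableT_comp (measurable_powR s)).
by apply: continuous_measurable_mx; exact: (continuous_dist_compl OmegaNT).
Qed.

Lemma measurable_energy u : Lip0 Omega u -> measurable_fun setT (EFin \o energy u).
Proof.
move=> /Lip0_continuous cu; apply/measurable_EFinP; apply: measurable_funM.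
  by apply: (measurableT_comp (measurable_powR p)); exact: measurable_enorm_gradient.
exact: measurable_dist_powR.
Qed.

Lemma continuous_norm_comp u : continuous u -> continuous (fun x => `|u x|).
Proof.
by move=> cu x; apply: continuous_comp; [exact: cu|exact: norm_continuous].
Qed.

Lemma measurable_hardy_term u : Lip0 Omega u ->
  measurable_fun setT (EFin \o hardy_term u).
Proof.
move=> /Lip0_continuous cu; apply/measurable_EFinP; apply: measurable_funM.
  apply: (measurableT_comp (measurable_powR p)).
  by apply: continuous_measurable_mx; exact: continuous_norm_comp.
exact: measurable_dist_powR.
Qed.

Hypotheses (C0 : 0 < C) (Hpw : pointwise_hardy).

(** If every mean over these balls were smaller, the maximal function would be
    at most [(t / (2 * C)) `^ p * d x `^ (beta - p)], and the pointwise
    inequality would give [`|v x| <= t / 2]. The factor [2] makes this a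
    contradiction although the supremum need not be attained. *)
Lemma pointwise_hardy_ball v x t : Omega x -> Lip0 Omega v -> 0 < t -> t <= `|v x| ->
  exists r, [/\ 0 < r, r < 2 * d x &
    (((t / (2 * C)) `^ p * d x `^ (beta - p))%:E * mu (eball x r) <=
     \int[mu]_(y in eball x r) (energy v y)%:E)%E].
Proof.
move=> Ox Lv t0 tv; set s := _ * _ `^ _; apply: contrapT => Hno.
have p0 : 0 < p := lt_trans ltr01 p1.
have dx := dist_compl_gt0 OmegaNT oOmega Ox.
have s0 : 0 <= s by rewrite mulr_ge0 ?powR_ge0.
have Ms : (restricted_maximal (2 * d x) (energy v) x <= s%:E)%E.
  apply: ge_ereal_sup => _ [r /= + <-]; rewrite in_itv/= => /andP[r0 rd].
  have mfin := lebesgue_eball_fin x r0; have := lebesgue_eball_gt0 x r0.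
  have : ~ (s%:E * mu (eball x r) <= \int[mu]_(y in eball x r) (energy v y)%:E)%E.
    by move=> sr; apply: Hno; exists r.
  rewrite -(fineK mfin) lte_fin => /negP; rewrite -ltNge => sr m0.
  rewrite inver gt_eqF// lee_pdivrMl//.
  under eq_integral do rewrite ger0_norm ?energy_ge0//.
  by rewrite muleC ltW.
have H := Hpw Ox Lv.
have M0 : (0 <= restricted_maximal (2 * d x) (energy v) x)%E.
  apply: (@le_trans _ _ ((mu (eball x (d x)))^-1 *
     \int[mu]_(y in eball x (d x)) `|energy v y|%:E)%E).
    by apply: mule_ge0; rewrite ?inve_ge0//; apply: integral_ge0 => y _; rewrite lee_fin.
  apply: ereal_sup_ubound; exists (d x) => //=; rewrite in_itv/= dx/=; lra.
have : (`|v x|%:E <= (C * d x `^ (1 - beta / p))%:E * (s `^ (1 / p))%:E)%E.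
  apply: (le_trans H); apply: lee_wpmul2l.
    by rewrite lee_fin mulr_ge0 ?powR_ge0// ltW.
  rewrite -poweR_EFin; apply: gt0_ler_poweR => //.
  - by rewrite divr_ge0// ltW.
  - by rewrite in_itv/= M0 leey.
  - by rewrite in_itv/= lee_fin s0 leey.
rewrite -EFinM lee_fin; apply/negP; rewrite -ltNge; apply: lt_le_trans tv.
have -> : s `^ (1 / p) = t / (2 * C) * d x `^ ((beta - p) / p).
  rewrite /s powRM ?powR_ge0// -!powRrM mulrA mulr1 divff ?gt_eqF// powRr1//.
    by rewrite mulrA mulr1.
  by rewrite divr_ge0 ?mulr_ge0 ?ltW.
rewrite mulrACA -powRD; last by rewrite (gt_eqF dx) implybT.
rewrite (_ : 1 - beta / p + (beta - p) / p = 0); last first.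
  by rewrite mulrBl divff ?gt_eqF//; ring.
rewrite powRr0 mulr1 (_ : C * _ = t / 2); last by field; rewrite gt_eqF.
by rewrite ltr_pdivrMr// ltr_pMr// ltr1n.
Qed.

(** On the layer the weight [d] may be replaced by [expR m%:~R], which gives all
    the points of [A] the same threshold for the maximal function. *)
Lemma weak_layer m v t (A : set 'rV[R]_n) : Lip0 Omega v -> 0 < t -> measurable A ->
  A `<=` layer m -> (forall x, A x -> t <= `|v x|) ->
  (((t / (2 * C)) `^ p * (expR (- `|beta - p|) * expR ((beta - p) * m%:~R)))%:E * mu A <=
   (@vitali_cst R n)%:E * \int[mu]_(x in tube m) (energy v x)%:E)%E.
Proof.
move=> Lv t0 mA Am Av; apply: maximal_weak_type => //.
- exact: (measurable_tube OmegaNT).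
- exact: measurable_energy.
- by move=> x; rewrite lee_fin energy_ge0.
- by rewrite !mulr_ge0 ?powR_ge0 ?expR_ge0.
move=> x Ax; have [r [r0 rd rP]] := pointwise_hardy_ball (layer_subset OmegaNT (Am _ Ax)) Lv t0 (Av _ Ax).
exists r; split => //.
  move=> y xy /=; have /andP[_ dm] := Am _ Ax.
  have := lipschitz_dist_compl OmegaNT y x; rewrite mul1r enormB.
  by move: xy rd dm; rewrite /eball/tube/=; lra.
apply: le_trans rP; apply: lee_wpmul2r => //; rewrite lee_fin ler_wpM2l ?powR_ge0//.
by have /andP[] := layer_powR OmegaNT oOmega (beta - p) (Am _ Ax).
Qed.

End pointwise_to_weak.

Section dyadic_levels.
Context {R : realType}.
Implicit Types (c s p : R) (k : nat).

Lemma dyadic_level_unique c s k : 0 < c ->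
  \sum_(i < k) (if c * 2 ^+ i < s < 2 * (c * 2 ^+ i) then 1 else 0) <= 1 :> R.
Proof.
move=> c0; elim: k => [|k IH]; first by rewrite big_ord0.
rewrite big_ord_recr/=; case: ifP => [/andP[ks _]|_]; last by rewrite addr0.
rewrite big1 ?add0r// => i _; case: ifP => // /andP[_].
rewrite ltNge => /negP[]; rewrite (le_trans _ (ltW ks))// mulrCA ler_pM2l//.
by rewrite -exprS ler_weXn2l// ler1n.
Qed.

Lemma geometric_sum_le q k : 2 <= q -> \sum_(i < k.+1) q ^+ i <= 2 * q ^+ k :> R.
Proof.
move=> q2; elim: k => [|k IH]; first by rewrite big_ord_recr big_ord0/= expr0; lra.
rewrite big_ord_recr/= (_ : 2 * _ = q ^+ k.+1 + q ^+ k.+1); last by ring.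
rewrite lerD2r (le_trans IH)// exprS ler_pM2r// exprn_gt0//; lra.
Qed.

(** A geometric sum is comparable to its last term, here at the highest level
    below [s]. *)
Lemma dyadic_level_sum_le c s p k : 0 < c -> 1 <= p ->
  \sum_(i < k) (if c * 2 ^+ i < s then (c * 2 ^+ i) `^ p else 0) <= 2 * s `^ p.
Proof.
move=> c0 p1; elim: k => [|k IH]; first by rewrite big_ord0 mulr_ge0// powR_ge0.
have [ks|sk] := ltP (c * 2 ^+ k) s; last first.
  by rewrite big_ord_recr/= ltNge sk/= addr0.
have c2 i : 0 < c * 2 ^+ i by rewrite mulr_gt0// exprn_gt0.
apply: (@le_trans _ _ (\sum_(i < k.+1) (c * 2 ^+ i) `^ p)).
  by apply: ler_sum => i _; case: ifP => // _; exact: powR_ge0.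
have E i : (c * 2 ^+ i) `^ p = c `^ p * (2 `^ p) ^+ i.
  by rewrite powRM ?exprn_ge0 ?ltW// -!powR_mulrn ?powR_ge0// powRAC.
apply: (@le_trans _ _ (2 * (c * 2 ^+ k) `^ p)); last first.
  rewrite ler_pM2l//; apply: ge0_ler_powR; rewrite ?nnegrE ?(ltW (c2 _)) ?(ltW ks)//; first lra.
  by rewrite ltW// (lt_trans _ ks).
under eq_bigr do rewrite E.
rewrite E -mulr_sumr mulrCA ler_pM2l ?powR_gt0//; apply: geometric_sum_le.
by rewrite -[leLHS]powRr1// ler_powR// ler1n.
Qed.

Lemma dyadic_level_cover c s k :
  2 * c <= s -> s < 2 * (c * 2 ^+ k) ->
  exists i : 'I_k, 2 * (c * 2 ^+ i) <= s < 4 * (c * 2 ^+ i).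
Proof.
move=> cs; elim: k => [|k IH] sk; first by exfalso; move: sk; rewrite expr0; lra.
have [/IH[i iP]|ks] := ltP s (2 * (c * 2 ^+ k)); first by exists (widen_ord (leqnSn k) i).
exists ord_max; rewrite ks/=.
by rewrite (lt_le_trans sk)// exprS; lra.
Qed.

End dyadic_levels.

Section layer_hardy.
Context {R : realType} {n : nat}.
Local Notation mu := (@lebesgue_rV R n).
Variables (p beta C : R) (Omega : set 'rV[R]_n).
Local Notation d := (dist_compl Omega).
Local Notation F u := (energy p beta Omega u).
Local Notation H u := (hardy_term p beta Omega u).
Local Notation layer := (layer Omega).
Local Notation tube := (tube Omega).

Hypotheses (p1 : 1 < p) (OmegaNT : Omega <> setT) (oOmega : open Omega).
Hypotheses (C0 : 0 < C) (Hpw : pointwise_hardy p beta C Omega).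

Lemma energy_test_function u eta ell t x : cutoff eta ell -> 0 < t -> Lip0 Omega u ->
  F (test_function u eta t) x <=
    (if t < `|u x| < 2 * t then 1 else 0) * F u x +
    (if t < `|u x| then t `^ p else 0) * ((n%:R * ell x) `^ p * d x `^ beta).
Proof.
move=> ce t0 Lu; have p0 : 0 < p := lt_trans ltr01 p1.
have l0 := cutoff_slope_ge0 ce x.
have rhs0 : 0 <= (n%:R * ell x) `^ p * d x `^ beta by rewrite mulr_ge0 ?powR_ge0.
have [g0|[_ tu [gl|[u2 ge]]]] := test_function_gradient ce x t0 (Lip0_continuous Lu).
- rewrite {1}/energy g0 powR0 ?gt_eqF// mul0r addr_ge0// mulr_ge0//.
  + by case: ifP.
  + exact: energy_ge0.
  + by case: ifP => // _; exact: powR_ge0.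
- rewrite tu; apply: ler_wpDl.
    by apply: mulr_ge0; [case: ifP|exact: energy_ge0].
  rewrite mulrA -powRM ?mulr_ge0 ?(ltW t0)// /energy ler_wpM2r ?powR_ge0//.
  rewrite mulrCA; apply: ge0_ler_powR; rewrite ?nnegrE ?enorm_ge0 ?(ltW p0)//.
  by rewrite mulr_ge0// mulr_ge0// ltW.
- by rewrite tu u2 mul1r /energy ge lerDl mulr_ge0// powR_ge0.
Qed.

Lemma energy_test_function_supp u eta ell t x : cutoff eta ell -> 0 < t -> Lip0 Omega u ->
  ~ (Omega x /\ 0 < eta x) -> F (test_function u eta t) x = 0.
Proof.
move=> ce t0 Lu nW; have p0 : 0 < p := lt_trans ltr01 p1.
have [g0|[ex tu _]] := test_function_gradient ce x t0 (Lip0_continuous Lu).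
  by rewrite /energy g0 powR0 ?gt_eqF// mul0r.
exfalso; apply: nW; split => //; apply: contrapT => /(Lu.2 x) ux.
by move: tu; rewrite ux normr0 ltNge ltW.
Qed.

Definition shell (u : 'rV[R]_n -> R) (t : R) := [set x : 'rV[R]_n | 2 * t <= `|u x| < 4 * t].

Lemma measurable_shell u t : continuous u -> measurable (shell u t).
Proof.
move=> cu; rewrite (_ : shell u t = (fun x => `|u x|) @^-1` `[2 * t, 4 * t[%classic).
  rewrite -[X in measurable X]setTI; apply: continuous_measurable_mx => //.
  exact: continuous_norm_comp.
by apply/seteqP; split=> x /=; rewrite in_itv.
Qed.

(** The factor [4 `^ p] compares [`|u x|] with [t] on a shell, each factor
    [expR `|beta - p|] comes from an exchange of [d] and [expR m%:~R] on the
    layer, and the other ones from [weak_layer]. *)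
Definition layer_cst : R :=
  4 `^ p * expR `|beta - p| * ((2 * C) `^ p * expR `|beta - p| * @vitali_cst R n).

Lemma layer_cst_gt0 : 0 < layer_cst.
Proof. by rewrite !mulr_gt0 ?powR_gt0 ?expR_gt0 ?vitali_cst_gt0 ?mulr_gt0. Qed.

(** On the given part of the layer the test function equals [t], so that
    [weak_layer] bounds the measure of this part, on which [H u] is comparable
    to a constant. *)
Lemma layer_level u eta ell m t : cutoff eta ell -> 0 < t -> Lip0 Omega u ->
  (forall x, layer m x -> eta x = 1) ->
  (\int[mu]_(x in layer m `&` shell u t) (H u x)%:E <=
   layer_cst%:E * \int[mu]_(x in tube m) (F (test_function u eta t) x)%:E)%E.
Proof.
move=> ce t0 Lu e1; set s := beta - p; set v := test_function _ _ _.
have p0 : 0 < p := lt_trans ltr01 p1.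
have Lv : Lip0 Omega v := test_function_Lip0 ce t0 Lu.
have mA : measurable (layer m `&` shell u t).
  apply: measurableI; first exact: measurable_layer.
  exact: measurable_shell (Lip0_continuous Lu).
have vt x : (layer m `&` shell u t) x -> t <= `|v x|.
  by move=> [mx /andP[ux _]]; rewrite /v (test_function_eqt t0 (e1 x mx) ux) ler_norm.
have W := weak_layer p1 OmegaNT oOmega C0 Hpw Lv t0 mA (@subIsetl _ _ _) vt.
apply: (@le_trans _ _ (((4 * t) `^ p * (expR `|s| * expR (s * m%:~R)))%:E * 
    mu (layer m `&` shell u t))%E).
  rewrite -integral_cst//; apply: ge0_le_integral => //.
  - by move=> x _; rewrite lee_fin hardy_term_ge0.
  - by apply: measurable_funTS; exact: measurable_hardy_term.
  - move=> x [mx /andP[_ ux]]; rewrite lee_fin /hardy_term.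
    apply: ler_pM; rewrite ?powR_ge0//.
      by apply: ge0_ler_powR; rewrite ?nnegrE ?(ltW p0) ?mulr_ge0 ?(ltW t0)// ltW.
    by have /andP[] := layer_powR OmegaNT oOmega s mx.
have -> : (4 * t) `^ p * (expR `|s| * expR (s * m%:~R)) =
  4 `^ p * expR `|s| * ((2 * C) `^ p * expR `|s|) *
  ((t / (2 * C)) `^ p * (expR (- `|s|) * expR (s * m%:~R))).
  have e2 : expR `|s| * expR (- `|s|) = 1 :> R by rewrite -expRD subrr expR0.
  have -> : (4 * t) `^ p = 4 `^ p * ((2 * C) `^ p * (t / (2 * C)) `^ p).
    have C2 : 0 <= 2 * C by rewrite mulr_ge0 ?ltW.
    have tC : 0 <= t / (2 * C) by rewrite divr_ge0 ?(ltW t0).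
    have e3 : 2 * C * (t / (2 * C)) = t by field; rewrite gt_eqF.
    by rewrite -(powRM _ C2 tC) e3 powRM ?(ltW t0).
  set a := 4 `^ p; set b := (2 * C) `^ p; set e := (t / _) `^ p.
  set f := expR `|s|; set g := expR (s * _).
  transitivity (a * (b * e) * (f * g) * 1); first by rewrite mulr1.
  rewrite -e2 -/f; ring.
rewrite EFinM -muleA; apply: le_trans (lee_wpmul2l _ W) _.
  by rewrite lee_fin !mulr_ge0 ?powR_ge0 ?expR_ge0.
by rewrite muleA -EFinM /layer_cst -/s -!mulrA.
Qed.

End layer_hardy.

Section layer_estimate.
Context {R : realType} {n : nat}.
Local Notation mu := (@lebesgue_rV R n).
Variables (p beta C : R) (Omega : set 'rV[R]_n).
Local Notation d := (dist_compl Omega).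
Local Notation F u := (energy p beta Omega u).
Local Notation H u := (hardy_term p beta Omega u).
Local Notation layer := (layer Omega).
Local Notation tube := (tube Omega).

Hypotheses (p1 : 1 < p) (OmegaNT : Omega <> setT) (oOmega : open Omega).
Hypotheses (C0 : 0 < C) (Hpw : pointwise_hardy p beta C Omega).

Local Notation K := (@layer_cst R n p beta C).

Variables (u eta ell : 'rV[R]_n -> R) (m : int) (c : R) (W E : set 'rV[R]_n).
Hypotheses (ce : cutoff eta ell) (Lu : Lip0 Omega u).
Hypothesis eta1 : forall x, layer m x -> eta x = 1.
Hypotheses (mW : measurable W) (mE : measurable E) (WOmega : W `<=` Omega) (c0 : 0 <= c).
Hypothesis WP : forall x, Omega x -> tube m x -> 0 < eta x -> W x.
(* On [W] it bounds [`|u x| `^ p * (n%:R * ell x) `^ p * d x `^ beta] by a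
   multiple of [H u x]. *)
Hypothesis ellP : forall x, W x ->
  (n%:R * ell x) `^ p <= if x \in E then c * d x `^ (- p) else 0.

Let B x : R := F u x + 2 * c * ((H u) \_ E) x.

Let levels_le (b : R) k x : 0 < b -> W x ->
  \sum_(i < k) F (test_function u eta (b * 2 ^+ i)) x <= B x.
Proof.
move=> b0 Wx; apply: (@le_trans _ _ (\sum_(i < k)
   ((if b * 2 ^+ i < `|u x| < 2 * (b * 2 ^+ i) then 1 else 0) * F u x +
    (if b * 2 ^+ i < `|u x| then (b * 2 ^+ i) `^ p else 0) *
      ((n%:R * ell x) `^ p * d x `^ beta)))).
  apply: ler_sum => i _; apply: energy_test_function => //.
  by rewrite mulr_gt0// exprn_gt0.
rewrite big_split/= -!mulr_suml; apply: lerD.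
  rewrite ler_piMl// ?energy_ge0//; exact: dyadic_level_unique.
apply: (@le_trans _ _ (2 * `|u x| `^ p * ((n%:R * ell x) `^ p * d x `^ beta))).
  by rewrite ler_wpM2r ?mulr_ge0 ?powR_ge0// dyadic_level_sum_le// ltW.
have dx : 0 < d x by apply: dist_compl_gt0 => //; exact: WOmega.
rewrite -!mulrA ler_pM2l//; rewrite /patch.
have := ellP Wx; case: ifPn => xE lx.
  apply: (@le_trans _ _ (`|u x| `^ p * (c * d x `^ (- p) * d x `^ beta))).
    by rewrite ler_wpM2l ?powR_ge0// ler_wpM2r ?powR_ge0.
  rewrite -mulrA -powRD; last by rewrite (gt_eqF dx) implybT.
  by rewrite /hardy_term mulrCA addrC.
rewrite mulr0; apply: mulr_ge0_le0; first exact: powR_ge0.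
by rewrite mulr_le0_ge0 ?powR_ge0.
Qed.

Let measurable_B : measurable_fun setT (EFin \o B).
Proof.
apply/measurable_EFinP; apply: measurable_funD.
  by apply/measurable_EFinP; exact: measurable_energy.
apply: measurable_funM; first exact: measurable_cst.
apply/(measurable_restrictT _ _).1 => //; apply: measurable_funTS.
by apply/measurable_EFinP; exact: measurable_hardy_term.
Qed.

Let B_ge0 x : 0 <= B x.
Proof.
apply: addr_ge0; first exact: energy_ge0.
by rewrite !mulr_ge0// /patch; case: ifP => // _; exact: hardy_term_ge0.
Qed.

Let levels_integral_le (b : R) k : 0 < b ->
  (\int[mu]_(x in layer m `&` [set x | (2 * b <= `|u x| < 2 * (b * 2 ^+ k))%R]) (H u x)%:E <=
   K%:E * \int[mu]_(x in W) (B x)%:E)%E.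
Proof.
move=> b0; have b20 i : 0 < b * 2 ^+ i by rewrite mulr_gt0// exprn_gt0.
have mH := measurable_hardy_term p beta OmegaNT Lu.
have cu := Lip0_continuous Lu.
have mL := measurable_layer OmegaNT m.
have mU := measurable_tube OmegaNT m.
have K0 : (0 <= K%:E)%E by rewrite lee_fin ltW// layer_cst_gt0.
have mP : measurable [set x | 2 * b <= `|u x| < 2 * (b * 2 ^+ k)].
  rewrite (_ : mkset _ = (fun x => `|u x|) @^-1` `[2 * b, 2 * (b * 2 ^+ k)[%classic).
    rewrite -[X in measurable X]setTI; apply: continuous_measurable_mx => //.
    exact: continuous_norm_comp.
  by apply/seteqP; split=> x /=; rewrite in_itv.
pose Bi (i : 'I_k) := layer m `&` shell u (b * 2 ^+ i).
apply: (@le_trans _ _ (\sum_(i < k) \int[mu]_(x in Bi i) (H u x)%:E)%E).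
  apply: integral_seq_cover_le => //.
  - exact: measurableI.
  - by move=> i; apply: measurableI => //; exact: measurable_shell.
  - by move=> x; rewrite lee_fin hardy_term_ge0.
  - move=> x [mx /= /andP[bu ub]]; have [i iP] := dyadic_level_cover bu ub.
    by exists i; [rewrite mem_index_enum|split].
apply: (@le_trans _ _ (\sum_(i < k) K%:E *
    \int[mu]_(x in tube m) (F (test_function u eta (b * 2 ^+ i)) x)%:E)%E).
  by apply: lee_sum => i _; exact: (layer_level p1 OmegaNT oOmega C0 Hpw ce).
have Fi0 (i : 'I_k) x : (0 <= (F (test_function u eta (b * 2 ^+ i)) x)%:E)%E.
  by rewrite lee_fin energy_ge0.
have mFi (i : 'I_k) : measurable_fun setT (fun x => (F (test_function u eta (b * 2 ^+ i)) x)%:E).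
  exact: (measurable_energy p beta OmegaNT (test_function_Lip0 ce (b20 i) Lu)).
rewrite -ge0_sume_distrr; last by move=> i _; apply: integral_ge0.
apply: lee_wpmul2l => //.
rewrite -ge0_integral_sum//; last by move=> i; exact: measurable_funTS.
rewrite (@integral_support _ _ _ mu _ W); last first.
  move=> x Ux nWx; rewrite big1// => i _.
  by rewrite (energy_test_function_supp beta p1 ce)// => -[Ox ex]; apply: nWx; exact: WP.
have mUW : measurable (tube m `&` W) by exact: measurableI.
apply: (@le_trans _ _ (\int[mu]_(x in tube m `&` W) (B x)%:E)%E).
  apply: ge0_le_integral => //.
  - by move=> x _; apply: sume_ge0.
  - by apply: emeasurable_sum => i; exact: measurable_funTS.
  - exact: measurable_funTS.
  - by move=> x [_ Wx]; rewrite sumEFin lee_fin; exact: levels_le.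
apply: ge0_subset_integral => //; first exact: measurable_funTS.
by move=> x _; rewrite lee_fin.
Qed.

(** The level sets of [u] are summed here. Only finitely many levels are summed
    at a time, and monotone convergence gives the whole layer. *)
Lemma layer_estimate :
  (\int[mu]_(x in layer m) (H u x)%:E <=
   K%:E * (\int[mu]_(x in W) (F u x)%:E + (2 * c)%:E * \int[mu]_(x in W `&` E) (H u x)%:E))%E.
Proof.
have p0 : 0 < p := lt_trans ltr01 p1.
have mH := measurable_hardy_term p beta OmegaNT Lu.
have cabs := continuous_norm_comp (Lip0_continuous Lu).
have mL := measurable_layer OmegaNT m.
have mabs (D : set R) : measurable D -> measurable ((fun x => `|u x|) @^-1` D).
  by move=> mD; rewrite -[X in measurable X]setTI; exact: continuous_measurable_mx.
have HE0 x : (0 <= ((H u) \_ E) x)%R.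
  by rewrite /patch; case: ifP => // _; exact: hardy_term_ge0.
have -> : (\int[mu]_(x in W) (F u x)%:E + (2 * c)%:E * \int[mu]_(x in W `&` E) (H u x)%:E =
    \int[mu]_(x in W) (B x)%:E)%E.
  rewrite integral_mkcondr -ge0_integralZl_EFin//; last 3 first.
  - by move=> x _; apply: erestrict_ge0 => y _; rewrite lee_fin hardy_term_ge0.
  - apply/(measurable_restrict _ _ _).1 => //; exact: measurable_funTS.
  - by rewrite mulr_ge0.
  rewrite -ge0_integralD//; last 4 first.
  - by move=> x _; rewrite lee_fin energy_ge0.
  - by apply: measurable_funTS; exact: measurable_energy.
  - move=> x _; apply: mule_ge0; first by rewrite lee_fin mulr_ge0.
    by apply: erestrict_ge0 => y _; rewrite lee_fin hardy_term_ge0.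
  - apply: emeasurable_funM; first exact: measurable_cst.
    apply/(measurable_restrict _ _ _).1 => //; exact: measurable_funTS.
  apply: eq_integral => x _; rewrite /B EFinD (EFinM (2 * c)).
  by congr (_ + _ * _)%E; rewrite /patch; case: ifP.
(* where u vanishes so does H u, and no dyadic level is needed *)
rewrite (@integral_support _ _ _ mu _ [set x | 0 < `|u x|]); last first.
  move=> x _ /negP; rewrite -leNgt normr_le0 => /eqP ux.
  by rewrite /hardy_term ux normr0 powR0 ?gt_eqF ?mul0r.
have mN0 : measurable [set x | 0 < `|u x|].
  rewrite (_ : mkset _ = (fun x => `|u x|) @^-1` `]0, +oo[%classic); first exact: mabs.
  by apply/seteqP; split=> x /=; rewrite in_itv/= andbT.
pose P N := [set x | 2 * (2 ^- N) <= `|u x| < 2 * (2 ^- N * 2 ^+ (N + N))].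
have PE N : 2 ^- N * 2 ^+ (N + N) = 2 ^+ N :> R.
  by rewrite exprD mulrA mulVf ?mul1r// expf_neq0.
have mP N : measurable (P N).
  rewrite (_ : P N = (fun x => `|u x|) @^-1` `[2 * (2 ^- N), 2 * (2 ^- N * 2 ^+ (N + N))[%classic).
    exact: mabs.
  by apply/seteqP; split=> x /=; rewrite in_itv.
apply: (@integral_exhaustion_le _ _ _ mu _ P).
- exact: measurableI.
- exact: mP.
- move=> k l kl x /andP[k1 k2]; apply/andP; split.
    apply: le_trans k1; rewrite ler_pM2l// lef_pV2 ?posrE ?exprn_gt0//.
    by rewrite ler_weXn2l// ler1n.
  apply: (lt_le_trans k2); rewrite !PE ler_pM2l//.
  by rewrite ler_weXn2l// ler1n.
- move=> x [_ /= u0]; have [N1 N1P] : exists N : nat, `|u x| < N%:R.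
    by exists (Num.truncn `|u x|).+1; rewrite truncnS_gt.
  have [N2 N2P] : exists N : nat, 2 / `|u x| < N%:R.
    by exists (Num.truncn (2 / `|u x|)).+1; rewrite truncnS_gt.
  have up k : k%:R <= 2 ^+ k :> R by rewrite -natrX ler_nat ltnW// ltn_expl.
  exists (N1 + N2)%N => //; apply/andP; split.
    rewrite ler_pdivrMr ?exprn_gt0// mulrC -ler_pdivrMr//.
    rewrite (le_trans (ltW N2P))// (le_trans (up N2))// ler_weXn2l ?ler1n//.
    exact: leq_addl.
  rewrite PE (lt_le_trans N1P)// (le_trans (up N1))//.
  rewrite (@le_trans _ _ (2 ^+ (N1 + N2)))//; first by rewrite ler_weXn2l ?ler1n// leq_addr.
  by rewrite ler_peMl ?exprn_ge0// ler1n.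
- by apply: measurable_funTS.
- by move=> x _; rewrite lee_fin hardy_term_ge0.
move=> N; apply: le_trans (levels_integral_le (N + N) (_ : 0 < 2 ^- N)).
  apply: ge0_subset_integral => //.
  - by apply: measurableI; [exact: measurableI|exact: mP].
  - by apply: measurableI; [exact: mL|exact: (mP N)].
  - exact: measurable_funTS.
  - by move=> x _; rewrite lee_fin hardy_term_ge0.
  - by move=> x [[]].
by rewrite invr_gt0 exprn_gt0.
Qed.

End layer_estimate.

(** * Summation over the layers *)

Section absorption.
Context {R : realType}.
Implicit Types (J G : int -> R) (K c Gt : R) (M L : nat) (a : int).

(** Each shift by one brings in at most one new term. *)
Lemma sum_shift_le J B a L k : (forall m, 0 <= J m) -> (forall m, J m <= B) ->
  \sum_(i < L) J (a + i%:Z - k%:Z) <= \sum_(i < L) J (a + i%:Z) + k%:R * B.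
Proof.
move=> J0 JB; elim: k => [|k IH].
  by rewrite mul0r addr0; apply: ler_sum => i _; rewrite subr0.
apply: (@le_trans _ _ (J (a - k.+1%:Z) + \sum_(i < L) J (a + i%:Z - k%:Z))); last first.
  have := JB (a - k.+1%:Z); rewrite -natr1 mulrDl mul1r; move: IH; lra.
case: L {IH} => [|L]; first by rewrite !big_ord0 addr0.
rewrite big_ord_recl/= addr0 lerD2l big_ord_recr/= ler_wpDr//.
apply: ler_sum => i _; rewrite le_eqVlt; apply/orP; left; apply/eqP; congr J.
rewrite /bump/=; lia.
Qed.

(** Summed over [L] consecutive layers, the last hypothesis on [J] bounds the sum
    of the [J m] by a multiple of [Gt] plus [K * c * M%:R] times this same sum,
    up to the shifts that [sum_shift_le] controls. At most half of the sum is
    thus moved back to the left. *)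
Lemma layer_absorption J G K c Gt M : 0 <= K -> 0 <= c -> 0 <= Gt ->
  (forall m, 0 <= J m) -> (forall m, J m <= K * Gt) ->
  (forall a L, \sum_(i < L) G (a + i%:Z) <= Gt) ->
  (forall m, J m <= K * (\sum_(k < M + 3) G (m + 2 - k%:Z) +
                         c * \sum_(k < M) J (m - 1 - k%:Z))) ->
  K * c * M%:R <= 2^-1 ->
  forall a L, \sum_(i < L) J (a + i%:Z) <= (2 * K * (M + 3)%:R + K * M%:R) * Gt.
Proof.
move=> K0 c0 Gt0 J0 JK GGt JM KcM a L; set S := \sum_(i < L) _.
have B0 : 0 <= K * Gt by rewrite mulr_ge0.
have S1 : S <= K * (\sum_(k < M + 3) \sum_(i < L) G (a + 2 - k%:Z + i%:Z) +
                    c * \sum_(k < M) \sum_(i < L) J (a + i%:Z - k.+1%:Z)).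
  rewrite [X in X + _]exchange_big/= [X in c * X]exchange_big/= mulr_sumr.
  rewrite -big_split/= mulr_sumr; apply: ler_sum => i _.
  apply: (le_trans (JM _)); rewrite le_eqVlt; apply/orP; left; apply/eqP.
  congr (_ * (_ + _ * _)); apply: eq_bigr => k _; [congr G|congr J]; lia.
have S2 : \sum_(k < M + 3) \sum_(i < L) G (a + 2 - k%:Z + i%:Z) <= (M + 3)%:R * Gt.
  apply: (@le_trans _ _ (\sum_(k < M + 3) Gt)); first by apply: ler_sum => k _; exact: GGt.
  by rewrite sumr_const card_ord mulr_natl.
have S3 : \sum_(k < M) \sum_(i < L) J (a + i%:Z - k.+1%:Z) <= M%:R * (S + M%:R * (K * Gt)).
  apply: (@le_trans _ _ (\sum_(k < M) (S + M%:R * (K * Gt)))); last first.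
    by rewrite sumr_const card_ord -[leLHS]mulr_natl.
  apply: ler_sum => k _; apply: (le_trans (sum_shift_le _ _ _ J0 JK)).
  by rewrite lerD2l ler_wpM2r// ler_nat.
have S4 : S <= K * ((M + 3)%:R * Gt) + K * c * M%:R * (S + M%:R * (K * Gt)).
  apply: (le_trans S1); rewrite mulrDr; apply: lerD; first by rewrite ler_wpM2l.
  by rewrite -!mulrA ler_wpM2l// ler_wpM2l.
have S0 : 0 <= S + M%:R * (K * Gt).
  by rewrite addr_ge0 ?mulr_ge0// /S sumr_ge0.
have := ler_wpM2r S0 KcM.
have -> : (2 * K * (M + 3)%:R + K * M%:R) * Gt = 2 * (K * ((M + 3)%:R * Gt)) + M%:R * (K * Gt).
  by ring.
move: S4; set X := K * c * _ * _; set Y := K * (_ * Gt); set Z := M%:R * _; lra.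
Qed.

End absorption.

Section hardy.
Context {R : realType} {n : nat}.
Local Notation mu := (@lebesgue_rV R n).
Variables (p beta C : R) (Omega : set 'rV[R]_n).
Local Notation d := (dist_compl Omega).
Local Notation F u := (energy p beta Omega u).
Local Notation H u := (hardy_term p beta Omega u).
Local Notation layer := (layer Omega).
Local Notation tube := (tube Omega).
Local Notation K := (@layer_cst R n p beta C).

Hypotheses (p1 : 1 < p) (OmegaNT : Omega <> setT) (oOmega : open Omega).
Hypotheses (C0 : 0 < C) (Hpw : pointwise_hardy p beta C Omega).

Variable u : 'rV[R]_n -> R.
Hypothesis Lu : Lip0 Omega u.

Let mO : measurable Omega. Proof. exact: open_measurable_mx. Qed.

(** The constant cutoff, for which no term in [H u] appears. *)
Lemma layer_estimate_total m :
  (\int[mu]_(x in layer m) (H u x)%:E <= K%:E * \int[mu]_(x in Omega) (F u x)%:E)%E.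
Proof.
have p0 : 0 < p := lt_trans ltr01 p1.
have := @layer_estimate R n p beta C Omega p1 OmegaNT oOmega C0 Hpw u _ _ m 0 Omega set0
  cutoff1 Lu.
rewrite setI0 integral_set0 mule0 adde0; apply => //.
by move=> x _; rewrite in_set0 mulr0 powR0// gt_eqF.
Qed.

(** The logarithmic cutoff. Its gradient lives on the [M] layers before the layer
    [m]. The two layers after it, which the tube meets, come from the inequality
    [3 < expR 2]. *)
Lemma layer_estimate_cutoff m (M : nat) : (0 < M)%N ->
  (\int[mu]_(x in layer m) (H u x)%:E <= K%:E *
    (\sum_(k < M + 3) \int[mu]_(x in layer (m + 2 - k%:Z)) (F u x)%:E +
     (2 * (n%:R / M%:R) `^ p)%:E *
       \sum_(k < M) \int[mu]_(x in layer (m - 1 - k%:Z)) (H u x)%:E))%E.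
Proof.
move=> M0; have p0 : 0 < p := lt_trans ltr01 p1; have M0' : 0 < M%:R :> R by rewrite ltr0n.
pose a : R := expR (m - 1 - M%:Z)%:~R.
have a0 : 0 < a by exact: expR_gt0.
have aM : a * expR M%:R = expR (m - 1)%:~R.
  by rewrite /a -expRD; congr expR; rewrite !rmorphB/= -pmulrn subrK.
have d1 := lipschitz_dist_compl OmegaNT.
pose W := tube m `&` [set x | a < d x]; pose E := [set x | d x < a * expR M%:R].
have mH := measurable_hardy_term p beta OmegaNT Lu.
have mF := measurable_energy p beta OmegaNT Lu.
have mdist (D : set R) : measurable D -> measurable (d @^-1` D).
  exact: measurable_preimage_dist.
have mW : measurable W.
  apply: measurableI; first exact: measurable_tube.
  rewrite (_ : mkset _ = d @^-1` `]a, +oo[%classic); first exact: mdist.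
  by apply/seteqP; split=> x /=; rewrite in_itv/= andbT.
have mE : measurable E.
  rewrite (_ : E = d @^-1` `]-oo, a * expR M%:R[%classic); first exact: mdist.
  by apply/seteqP; split=> x /=; rewrite in_itv/=.
have WO : W `<=` Omega.
  move=> x [_ /= ax]; apply: contrapT => /(dist_compl0 OmegaNT) dx.
  by move: ax; rewrite dx ltNge ltW.
have Wrange x : W x -> exists j : int, [/\ layer j x, j <= m + 2 & m - 1 - M%:Z < j].
  move=> Wx; have [j jx] := layer_cover OmegaNT oOmega (WO _ Wx).
  exists j; split => //.
    apply: (layer_index_le jx); apply: (le_trans (ltW Wx.1)).
    rewrite rmorphD/= expRD mulrC ler_wpM2l ?expR_ge0//.
    have := expR_ge1Dx (1 : R) => e1; have -> : 2%:~R = 1 + 1 :> R by rewrite -natr1.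
    rewrite expRD; nra.
  exact: (layer_index_gt jx Wx.2).
have D0 : 0 <= (n%:R / M%:R : R) `^ p by exact: powR_ge0.
have ce := log_cutoff_cutoff d1 (dist_compl_ge0 OmegaNT) a0 M0'.
apply: le_trans (layer_estimate p1 OmegaNT oOmega C0 Hpw ce Lu _ mW mE WO D0 _ _) _.
- move=> x /andP[mx _]; apply: log_cutoff_eq1 => //; rewrite aM ltW//.
  by rewrite rmorphB.
- by move=> x Ox tx ex; split => //; exact: log_cutoff_gt0 ex.
- move=> x Wx; have dx : 0 < d x by exact: lt_trans a0 Wx.2.
  rewrite /log_cutoff_slope; case: ifPn => [e1|_]; last first.
    rewrite mulr0 powR0 ?gt_eqF//.
    by case: ifP => // _; rewrite mulr_ge0 ?powR_ge0.
  rewrite mem_set; last exact: log_cutoff_lt1 e1.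
  rewrite invfM mulrA powRM ?divr_ge0 ?ler0n ?invr_ge0 ?(ltW dx)//.
  by rewrite -(powR_inv1 (ltW dx)) -powRrM mulN1r.
apply: lee_wpmul2l; first by rewrite lee_fin ltW// layer_cst_gt0.
apply: leeD.
  apply: integral_seq_cover_le => //.
  - by move=> k; exact: measurable_layer.
  - by move=> x; rewrite lee_fin energy_ge0.
  - move=> x /Wrange[j [jx j1 j2]].
    have kM : (absz (m + 2 - j)%R < M + 3)%N by lia.
    exists (Ordinal kM); first by rewrite mem_index_enum.
    by rewrite /= (_ : _ - _ = j)//; lia.
apply: lee_wpmul2l; first by rewrite lee_fin mulr_ge0.
apply: integral_seq_cover_le => //.
- exact: measurableI.
- by move=> k; exact: measurable_layer.
- by move=> x; rewrite lee_fin hardy_term_ge0.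
- move=> x [/Wrange[j [jx _ j2]] Ex].
  have j3 : j <= m - 1 by apply: (layer_index_le jx); rewrite -aM; exact: ltW.
  have kM : (absz (m - 1 - j)%R < M)%N by lia.
  exists (Ordinal kM); first by rewrite mem_index_enum.
  by rewrite /= (_ : _ - _ = j)//; lia.
Qed.

Lemma sum_layer_hardy (M : nat) (a : int) L : (0 < M)%N ->
  K * (2 * (n%:R / M%:R) `^ p) * M%:R <= 2^-1 ->
  (\sum_(i < L) \int[mu]_(x in layer (a + i%:Z)) (H u x)%:E <=
   (2 * K * (M + 3)%:R + K * M%:R)%:E * \int[mu]_(x in Omega) (F u x)%:E)%E.
Proof.
move=> M0 KM; have K0 : 0 < K by exact: layer_cst_gt0.
have M0' : 0 < M%:R :> R by rewrite ltr0n.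
set C' := 2 * K * _ + _; have C'0 : 0 < C'.
  have M3 : 0 < (M + 3)%:R :> R by rewrite ltr0n addn_gt0 orbT.
  apply: addr_gt0; last exact: mulr_gt0.
  by apply: mulr_gt0 => //; exact: mulr_gt0.
have mF := measurable_energy p beta OmegaNT Lu.
have G0 : (0 <= \int[mu]_(x in Omega) (F u x)%:E)%E.
  by apply: integral_ge0 => x _; rewrite lee_fin energy_ge0.
have [Goo|Gfin] := eqVneq (\int[mu]_(x in Omega) (F u x)%:E)%E +oo%E.
  by rewrite Goo gt0_muley ?lte_fin// leey.
have {}Gfin : (\int[mu]_(x in Omega) (F u x)%:E)%E \is a fin_num by rewrite ge0_fin_numE// ltey.
set Gt := fine (\int[mu]_(x in Omega) (F u x)%:E)%E.
have GtE : (\int[mu]_(x in Omega) (F u x)%:E = Gt%:E)%E by rewrite fineK.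
pose J m := fine (\int[mu]_(x in layer m) (H u x)%:E)%E.
pose G m := fine (\int[mu]_(x in layer m) (F u x)%:E)%E.
have JE m : (\int[mu]_(x in layer m) (H u x)%:E = (J m)%:E)%E.
  rewrite /J fineK// ge0_fin_numE.
    by apply: le_lt_trans (layer_estimate_total m) _; rewrite GtE ltry.
  by apply: integral_ge0 => x _; rewrite lee_fin hardy_term_ge0.
have GE m : (\int[mu]_(x in layer m) (F u x)%:E = (G m)%:E)%E.
  rewrite /G fineK// ge0_fin_numE; last first.
    by apply: integral_ge0 => x _; rewrite lee_fin energy_ge0.
  apply: le_lt_trans (ltry Gt); rewrite -GtE; apply: ge0_subset_integral => //.
  - exact: measurable_layer.
  - exact: measurable_funTS.
  - by move=> x _; rewrite lee_fin energy_ge0.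
  - exact: layer_subset.
under eq_bigr do rewrite JE.
rewrite sumEFin GtE -EFinM lee_fin.
apply: (layer_absorption (c := 2 * (n%:R / M%:R) `^ p) (G := G)) KM _ _; rewrite ?(ltW K0)//.
- by rewrite fine_ge0.
- by move=> m; rewrite fine_ge0//; apply: integral_ge0 => x _; rewrite lee_fin hardy_term_ge0.
- by move=> m; rewrite -lee_fin -JE EFinM -GtE; exact: layer_estimate_total.
- move=> b N; rewrite -lee_fin -GtE -sumEFin; under eq_bigr do rewrite -GE.
  by apply: (sum_layer_le OmegaNT oOmega) => // x; exact: energy_ge0.
- move=> m; rewrite -lee_fin -JE (EFinM K) EFinD (EFinM (2 * (n%:R / M%:R) `^ p)) -!sumEFin.
  under [X in (_ * (X + _))%E]eq_bigr do rewrite -GE.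
  under [X in (_ * (_ + _ * X))%E]eq_bigr do rewrite -JE.
  exact: layer_estimate_cutoff.
Qed.

End hardy.

(** The hypothesis [1 < p] enters here: a cutoff spread over [M] layers gains
    [M%:R `^ (- p)], which beats the [M] overlaps. *)
Lemma absorption_window (R : realType) (p B : R) : 1 < p -> 0 <= B ->
  exists2 M : nat, (0 < M)%N & B * M%:R `^ (- p) * M%:R <= 1.
Proof.
move=> p1 B0; have q0 : 0 < p - 1 by lra.
exists (Num.truncn (B `^ (p - 1)^-1)).+1 => //.
set M := _.+1; have M0 : 0 < M%:R :> R by rewrite ltr0n.
have BM : B <= M%:R `^ (p - 1).
  have -> : B = (B `^ (p - 1)^-1) `^ (p - 1).
    by rewrite -powRrM mulVf ?gt_eqF// powRr1.
  apply: ge0_ler_powR; rewrite ?nnegrE ?powR_ge0 ?(ltW q0)//.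
  by rewrite ltW// truncnS_gt.
rewrite -mulrA -{2}[M%:R]powRr1 ?(ltW M0)// -powRD; last by rewrite (gt_eqF M0) implybT.
have -> : - p + 1 = - (p - 1) by ring.
by rewrite powRN ler_pdivrMr ?mul1r// powR_gt0.
Qed.

Theorem theorem8p4 (R : realType) (n : nat) (p beta : R)
    (Omega : set 'rV[R]_n) :
  1 < p -> 0 <= beta ->
  open Omega -> Omega !=set0 -> Omega <> setT ->
  (exists2 C : R, 0 < C &
    forall (u : 'rV[R]_n -> R) (x : 'rV[R]_n), Omega x -> Lip0 Omega u ->
    (`|u x|%:E <=
      (C * dist_compl Omega x `^ (1 - beta / p))%:E *
      (restricted_maximal (2 * dist_compl Omega x)
         (fun y => enorm (gradient u y) `^ p * dist_compl Omega y `^ beta)%R x)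
        `^ (1 / p))%E) ->
  exists2 C' : R, 0 < C' &
    forall u : 'rV[R]_n -> R, Lip0 Omega u ->
    (\int[lebesgue_rV n]_(x in Omega)
        (`|u x| `^ p * dist_compl Omega x `^ (beta - p))%:E <=
     C'%:E * \int[lebesgue_rV n]_(x in Omega)
        (enorm (gradient u x) `^ p * dist_compl Omega x `^ beta)%:E)%E.
Proof.
move=> p1 _ oO _ OT [C C0 Hpw].
have K0 : 0 < @layer_cst R n p beta C by exact: layer_cst_gt0.
set K := layer_cst _ _ _ in K0.
have B0 : 0 <= 4 * K * n%:R `^ p 
  by apply: mulr_ge0; [apply: mulr_ge0 => //; exact: ltW|exact: powR_ge0].
have [M M0 MB] := absorption_window p1 B0.
have M0' : 0 < M%:R :> R by rewrite ltr0n.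
have M3 : 0 < (M + 3)%:R :> R by rewrite ltr0n addn_gt0 orbT.
exists (2 * K * (M + 3)%:R + K * M%:R).
  apply: addr_gt0; last exact: mulr_gt0.
  by apply: mulr_gt0 => //; exact: mulr_gt0.
move=> u Lu.
apply: (integral_le_sum_layer OT oO (f := hardy_term p beta Omega u)).
- exact: measurable_hardy_term.
- by move=> x; exact: hardy_term_ge0.
move=> a L.
apply: (sum_layer_hardy p1 OT oO C0 Hpw Lu) => //.
rewrite powRM ?invr_ge0 ?ler0n// -powR_inv1 ?(ltW M0')// -powRrM mulN1r.
move: MB; rewrite -/K; set x := n%:R `^ p; set y := _ `^ (- p).
rewrite (_ : 4 * K * x * y * M%:R = 2 * (K * (2 * (x * y)) * M%:R)); last by ring.
by lra.
Qed.
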